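(* Suppose there is $L>0$ such that $\|\nabla f(u)-\nabla f(v)\|\le L\|u-v\|$ for all $u,v\in\mathbb{R}^n$. In addition, suppose that $f$ is convex. Let $x_0\in\mathbb{R}^n$ be any initial point, let $\Omega$ be the set of optimal solutions of $\min_{x\in\mathbb{R}^n} f(x)$, and assume that $$R_0=\max_{x:\,f(x)\le f(x_0)}\ \min_{x^*\in\Omega}\|x-x^*\|$$ is finite. Let $(x_k)_{k\ge0}$ be the iterates generated from $x_0$ by the algorithm described in the context. Then for all $\epsilon\in(0,1)$ and for all $k\ge0$, $$\mathbb{E}[f(x_k)-f^*]\le\frac{L\,\mathcal{C}^2n^2R_0^2}{2\mathcal{C}^2n^2+L\,c\,M_1\,p(\epsilon)(1-\epsilon)^2d^2\,k\,\bar\alpha},$$ where $\bar\alpha:=\min\left(1,\frac{2\beta(1-c)}{mM_2L}\right)$.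
   Context: Setting. $f:\mathbb{R}^n\to\mathbb{R}$ is of class $C^2$, and $f^*$ is the optimal value of $\min_{x\in\mathbb{R}^n}f(x)$. $\|\cdot\|$ is the Euclidean norm for vectors and the operator norm for matrices. $d,m$ are positive integers, much smaller than $n$, with $m$ even. Parameters: $\beta,c\in(0,1)$ and $0<M_1\le M_2$. Algorithm (subspace gradients computed exactly). Input: $x_0\in\mathbb{R}^n$, a symmetric matrix $H_0\in\mathbb{R}^{m\times m}$ with $M_1I_m\preceq H_0\preceq M_2I_m$, and an initial $n\times m$ matrix with normalized columns. For $k=0,1,2,\dots$: 1. Sample $Q_k\in\mathbb{R}^{n\times d}$ with independent $N(0,1)$ entries, independent of everything generated before. 2. Set $$P_k=\left[\frac{x_{k-\frac m2+1}}{\|x_{k-\frac m2+1}\|},\frac{Q_{k-\frac m2+1}Q_{k-\frac m2+1}^{\top}\nabla f(x_{k-\frac m2+1})}{\|Q_{k-\frac m2+1}Q_{k-\frac m2+1}^{\top}\nabla f(x_{k-\frac m2+1})\|},\dots,\frac{x_k}{\|x_k\|},\frac{Q_kQ_k^{\top}\nabla f(x_k)}{\|Q_kQ_k^{\top}\nabla f(x_k)\|}\right]\in\mathbb{R}^{n\times m},$$ where any column with zero denominator is replaced by the zero vector. At each iteration the first two columns are dropped and the two new columns are appended at the end; for early iterations, columns with negative indices are taken from the initial matrix. Put $g_k(u):=f(x_k+P_ku)$ for $u\in\mathbb{R}^m$, so $\nabla g_k(0)=P_k^\top\nabla f(x_k)$. 3. $\mathbf{d}_k:=-H_k\nabla g_k(0)$.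 4. $\alpha_k:=\beta^i$, with $i\in\{0,1,2,\dots\}$ the smallest integer such that $f(x_k+\alpha_kP_k\mathbf{d}_k)\le g_k(0)+c\,\alpha_k\nabla g_k(0)^\top\mathbf{d}_k$. 5. $x_{k+1}:=x_k+\alpha_kP_k\mathbf{d}_k$. 6. With $s=\alpha_k\mathbf{d}_k$ and $y=\nabla g_k(\alpha_k\mathbf{d}_k)-\nabla g_k(0)$, set $\tilde H_{k+1}:=\left(I-\frac{sy^\top}{s^\top y}\right)H_k\left(I-\frac{ys^\top}{s^\top y}\right)+\frac{ss^\top}{s^\top y}$. 7. $H_{k+1}$ is obtained from $\tilde H_{k+1}$ by replacing its eigenvalues larger than $M_2$ by $M_2$ and those smaller than $M_1$ by $M_1$, so $M_1I_m\preceq H_{k+1}\preceq M_2I_m$. (If $s^\top y=0$, $H_{k+1}$ is any symmetric matrix determined by the history and satisfying these bounds.) Constants. $\mathcal{C}_0>0$ and $\mathcal{C}>0$ are constants such that, for a random $Q\in\mathbb{R}^{n\times d}$ with independent $N(0,1)$ entries: (i) for every $\epsilon\in(0,1)$ and $x\in\mathbb{R}^n$, $(1-\epsilon)\|x\|^2\le\|\frac1{\sqrt d}Q^\top x\|^2\le(1+\epsilon)\|x\|^2$ with probability at least $1-2e^{-\mathcal{C}_0\epsilon^2d}$; (ii) $\frac1d\|QQ^\top\|\le\mathcal{C}\frac nd$ with probability at least $1-2e^{-d}$. Set $p(\epsilon):=1-(2e^{-\mathcal{C}_0\epsilon^2d}+2e^{-d})$. Expectations are over all the matrices $Q_k$.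
   Formalization: The bound is claimed only for those ε and k for which its denominator is positive (automatic when p(ε) ≥ 0); for small ε, p(ε) < 0 and for large k the denominator becomes zero or negative, where the printed bound is undefined or, if R_0 > 0, false. *)

(* Defs.v *)
(* Vectors of R^n are columns 'cV[R]_n. The norm `|_| that
   the library puts on matrices is the sup norm: it only supplies the topology
   (continuity, differentiability), every norm of the statement is [enorm] or
   [opnorm]. *)
From HB Require Import structures.
From mathcomp Require Import all_boot all_order all_algebra.
From mathcomp Require Import all_classical all_reals all_analysis.

Set Implicit Arguments.
Unset Strict Implicit.
Unset Printing Implicit Defensive.

Import Order.TTheory GRing.Theory Num.Theory.
Import numFieldNormedType.Exports.

Local Open Scope classical_set_scope.
Local Open Scope ring_scope.

Section Euclidean.
Context {R : realType}.

Definition dotv n (u v : 'cV[R]_n) : R := (u^T *m v) 0 0.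

Definition enorm n (u : 'cV[R]_n) : R := Num.sqrt (dotv u u).

Definition opnorm m n (A : 'M[R]_(m, n)) : R :=
  sup [set enorm (A *m u) | u in [set u | enorm u <= 1]].

(* As 0^-1 = 0, the zero vector is sent to itself. *)
Definition normalize n (u : 'cV[R]_n) : 'cV[R]_n := (enorm u)^-1 *: u.

Definition loewner_le m (A B : 'M[R]_m) : Prop :=
  forall u : 'cV[R]_m, dotv u (A *m u) <= dotv u (B *m u).

Definition sym_between m (M1 M2 : R) (A : 'M[R]_m) : Prop :=
  [/\ A^T = A, loewner_le M1%:M A & loewner_le A M2%:M].

(* B is obtained from the symmetric matrix A by truncating its eigenvalues to
   [M1, M2] in an orthonormal eigenbasis, the columns of U; B does not depend
   on the choice of that basis. *)
Definition eigen_clip m (M1 M2 : R) (A B : 'M[R]_m) : Prop :=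
  exists (U : 'M[R]_m) (D : 'rV[R]_m),
    [/\ U^T *m U = 1%:M,
        A = U *m diag_mx D *m U^T &
        B = U *m diag_mx (map_mx (fun t => Num.max M1 (Num.min t M2)) D)
              *m U^T].

Definition grad n (f : 'cV[R]_n -> R) (x : 'cV[R]_n) : 'cV[R]_n :=
  \col_i 'D_(delta_mx i 0) f x.

Definition class_C2 n (f : 'cV[R]_n -> R) : Prop :=
  [/\ forall x, differentiable f x,
      forall x, differentiable (grad f) x &
      forall v, continuous (fun x => 'D_v (grad f) x)].

Definition optimal_value n (f : 'cV[R]_n -> R) : R := inf (range f).

Definition solutions n (f : 'cV[R]_n -> R) : set 'cV[R]_n :=
  [set x | forall y, f x <= f y].

(* Extended-real valued; it is +oo when there is no optimal solution, so that
   finiteness includes the existence of one. *)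
Definition level_radius n (f : 'cV[R]_n -> R) (x0 : 'cV[R]_n) : \bar R :=
  ereal_sup [set ereal_inf [set (enorm (x - z))%:E | z in solutions f]
            | x in [set x | f x <= f x0]].

End Euclidean.

Section Algorithm.
Context {R : realType} (n d m : nat).

Definition drop2_append (A : 'M[R]_(n, m)) (u v : 'cV[R]_n) : 'M[R]_(n, m) :=
  \matrix_(i, j)
    (if insub j.+2 is Some j' then A i j'
     else if j.+2 == m then u i 0 else v i 0).

Definition sketched_grad (f : 'cV[R]_n -> R) (Q : 'M[R]_(n, d))
  (x : 'cV[R]_n) : 'cV[R]_n := Q *m Q^T *m grad f x.

Fixpoint subspace_mx (f : 'cV[R]_n -> R) (Pinit : 'M[R]_(n, m))
    (Q : nat -> 'M[R]_(n, d)) (x : nat -> 'cV[R]_n) (k : nat) :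
    'M[R]_(n, m) :=
  drop2_append
    (if k is k'.+1 then subspace_mx f Pinit Q x k' else Pinit)
    (normalize (x k)) (normalize (sketched_grad f (Q k) (x k))).

Definition bfgs_update (H : 'M[R]_m) (s y : 'cV[R]_m) : 'M[R]_m :=
  let r := (dotv s y)^-1 in
  (1%:M - r *: (s *m y^T)) *m H *m (1%:M - r *: (y *m s^T))
    + r *: (s *m s^T).

(* One trajectory of the algorithm for fixed values Q k of the random matrices.
   Hdeg k is the matrix used as H_(k+1) when s^T y = 0. *)
Record subspace_qn_path (f : 'cV[R]_n -> R) (beta c M1 M2 : R)
    (x0 : 'cV[R]_n) (H0 : 'M[R]_m) (Pinit : 'M[R]_(n, m))
    (Q : nat -> 'M[R]_(n, d)) (Hdeg : nat -> 'M[R]_m)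
    (x : nat -> 'cV[R]_n) (H : nat -> 'M[R]_m) (alpha : nat -> R) : Prop := {
  path_x0 : x 0%N = x0;
  path_H0 : H 0%N = H0;
  path_step : forall k : nat,
    let P := subspace_mx f Pinit Q x k in
    let g := fun u : 'cV[R]_m => f (x k + P *m u) in
    let dir := - (H k *m grad g 0) in
    let armijo := fun a : R =>
      f (x k + a *: (P *m dir)) <= g 0 + c * a * dotv (grad g 0) dir in
    let s := alpha k *: dir in
    let y := grad g s - grad g 0 in
    [/\ exists i : nat, [/\ alpha k = beta ^+ i, armijo (beta ^+ i) &
          forall j : nat, (j < i)%N -> ~ armijo (beta ^+ j)],
        x k.+1 = x k + alpha k *: (P *m dir) &
        if dotv s y == 0 then H k.+1 = Hdeg k
        else eigen_clip M1 M2 (bfgs_update (H k) s y) (H k.+1)]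
}.

End Algorithm.

Section Randomness.
Context {disp : measure_display} {T : measurableType disp} {R : realType}
        (P : probability T R).

Definition mutually_independent (I : eqType) (X : I -> {RV P >-> R}) : Prop :=
  forall (J : seq I) (A : I -> set R), uniq J ->
    (forall i, measurable (A i)) ->
    P (\big[setI/setT]_(i <- J) (X i @^-1` A i))
      = (\prod_(i <- J) P (X i @^-1` A i))%E.

Definition iid_std_normal (I : eqType) (X : I -> {RV P >-> R}) : Prop :=
  mutually_independent X /\
  forall i A, measurable A -> distribution P (X i) A = normal_prob 0 1 A.

Definition rand_mx n d (G : 'I_n -> 'I_d -> {RV P >-> R}) (w : T) :
  'M[R]_(n, d) := \matrix_(i, j) G i j w.

Definition gaussian_mx n d (G : 'I_n -> 'I_d -> {RV P >-> R}) : Prop :=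
  iid_std_normal (fun t : 'I_n * 'I_d => G t.1 t.2).

(* Independence of all the entries, both inside each matrix and across k. *)
Definition gaussian_mx_seq n d (G : nat -> 'I_n -> 'I_d -> {RV P >-> R}) :
    Prop :=
  iid_std_normal (fun t : nat * 'I_n * 'I_d => G t.1.1 t.1.2 t.2).

(* The sigma-algebra generated by the matrices of index at most k. *)
Definition history n d (G : nat -> 'I_n -> 'I_d -> {RV P >-> R}) (k : nat) :
    set (set T) :=
  <<s [set B | exists j i l (A : set R),
         [/\ (j <= k)%N, measurable A & B = G j i l @^-1` A]] >>.

Definition history_determined n d m
    (G : nat -> 'I_n -> 'I_d -> {RV P >-> R}) (k : nat) (X : T -> 'M[R]_m) :
    Prop :=
  forall i j (A : set R), measurable A ->
    history G k ((fun w => X w i j) @^-1` A).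

Definition sketch_constant (n d : nat) (C0 : R) : Prop :=
  forall G : 'I_n -> 'I_d -> {RV P >-> R}, gaussian_mx G ->
  forall (eps : R) (x : 'cV[R]_n), 0 < eps < 1 ->
    ((1 - 2 * expR (- (C0 * eps ^+ 2 * d%:R)))%:E <=
     P [set w | ((1 - eps) * enorm x ^+ 2
          <= enorm ((Num.sqrt d%:R)^-1 *: ((rand_mx G w)^T *m x)) ^+ 2
          <= (1 + eps) * enorm x ^+ 2)%R])%E.

Definition gram_constant (n d : nat) (C : R) : Prop :=
  forall G : 'I_n -> 'I_d -> {RV P >-> R}, gaussian_mx G ->
    ((1 - 2 * expR (- d%:R))%:E <=
     P [set w | (d%:R^-1 * opnorm (rand_mx G w *m (rand_mx G w)^T)
                  <= C * (n%:R / d%:R))%R])%E.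

End Randomness.

Definition success_prob {R : realType} (d : nat) (C0 eps : R) : R :=
  1 - (2 * expR (- (C0 * eps ^+ 2 * d%:R)) + 2 * expR (- d%:R)).

Definition step_lower_bound {R : realType} (m : nat) (beta c M2 L : R) : R :=
  Num.min 1 (2 * beta * (1 - c) / (m%:R * M2 * L)).

(* Main.v *)
Require Import Defs.
From HB Require Import structures.
From mathcomp Require Import all_boot all_order all_algebra.
From mathcomp Require Import all_classical all_reals all_analysis.
From mathcomp Require Import measurable_realfun ring lra.

(** Write D_k = f(x_k) - f*, g_k for the gradient of f at x_k, and abar for the
    lower bound on the step size.

    For a fixed sequence of sketches, the descent lemma shows that the Armijo test
    accepts every step below 2 (1 - c) / (m M2 L), because the columns of P_k have
    norm at most 1 and H_k <= M2; hence backtracking stops at a step of size at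
    least abar, and f decreases by at least c abar M1 |P_k^T g_k|^2
    ([path_decrease]). One of the columns of P_k is the normalized sketched gradient
    Q_k Q_k^T g_k. If the k-th sketch is good for g_k, the cosine of its angle with
    g_k is at least (1 - eps) d / (C n), and the decrease is at least
    lam |g_k|^2 with lam = c abar M1 ((1 - eps) d / (C n))^2
    ([path_good_decrease]). By convexity D_k <= R0 |g_k| ([gap_le_grad]). So
    R0^2 D_(k+1) <= R0^2 D_k - lam D_k^2 when the sketch is good, and
    D_(k+1) <= D_k in all cases.

    The next point is that the k-th sketch is independent of x_k. All iterates are
    measurable functions of the earlier sketches ([iterates_past_measurable]). For
    the steps defined by formulas this is routine; the truncation of eigenvalues is
    given by a relation, and is measurable because it is a 1-Lipschitz map for the
    Frobenius norm ([eigen_clip_lipschitz], [measurable_lipschitz_factor]). A Dynkin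
    argument gives the independence of the past from the present sketch
    ([independent_families]), and Tonelli's theorem on the product of the two
    sigma-algebras then integrates the sketch with the iterate fixed
    ([integral_g_sigma_section_ge]): the mean of D_k^2 on the event that the sketch
    is good is at least p(eps) times the mean of D_k^2.

    With e_k the mean of D_k, whose square is at most the mean of D_k^2, this gives
    R0^2 e_(k+1) <= R0^2 e_k - lam p(eps) e_k^2. Moreover e_0 <= L R0^2 / 2, since
    the gradient vanishes at the solutions. The rate follows from this recursion by
    taking inverses ([quadratic_decrease_rate]). If p(eps) < 0, the claim is weaker
    than e_k <= e_0. *)

Set Implicit Arguments.
Unset Strict Implicit.
Unset Printing Implicit Defensive.

Import Order.TTheory GRing.Theory Num.Theory.
Import numFieldNormedType.Exports.

Local Open Scope classical_set_scope.
Local Open Scope ring_scope.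

(** * Euclidean norms and truncation of the spectrum *)

Section EuclideanTheory.
Context {R : realType}.

Lemma dotvE n (u v : 'cV[R]_n) : dotv u v = \sum_i u i 0 * v i 0.
Proof. by rewrite /dotv mxE; apply: eq_bigr => i _; rewrite mxE. Qed.

Lemma dotvC n (u v : 'cV[R]_n) : dotv u v = dotv v u.
Proof. by rewrite !dotvE; apply: eq_bigr => i _; rewrite mulrC. Qed.

Lemma dotvDr n (u v w : 'cV[R]_n) : dotv u (v + w) = dotv u v + dotv u w.
Proof. by rewrite /dotv mulmxDr mxE. Qed.

Lemma dotvZr n a (u v : 'cV[R]_n) : dotv u (a *: v) = a * dotv u v.
Proof. by rewrite /dotv -scalemxAr mxE. Qed.

Lemma dotvNr n (u v : 'cV[R]_n) : dotv u (- v) = - dotv u v.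
Proof. by rewrite -scaleN1r dotvZr mulN1r. Qed.

Lemma dotvBr n (u v w : 'cV[R]_n) : dotv u (v - w) = dotv u v - dotv u w.
Proof. by rewrite dotvDr dotvNr. Qed.

Lemma dotvDl n (u v w : 'cV[R]_n) : dotv (v + w) u = dotv v u + dotv w u.
Proof. by rewrite dotvC dotvDr !(dotvC u). Qed.

Lemma dotvZl n a (u v : 'cV[R]_n) : dotv (a *: v) u = a * dotv v u.
Proof. by rewrite dotvC dotvZr (dotvC u). Qed.

Lemma dotvNl n (u v : 'cV[R]_n) : dotv (- v) u = - dotv v u.
Proof. by rewrite dotvC dotvNr (dotvC u). Qed.

Lemma dotvBl n (u v w : 'cV[R]_n) : dotv (v - w) u = dotv v u - dotv w u.
Proof. by rewrite dotvC dotvBr !(dotvC u). Qed.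

Lemma dotv0r n (u : 'cV[R]_n) : dotv u 0 = 0.
Proof. by rewrite /dotv mulmx0 mxE. Qed.

Lemma dotv0l n (u : 'cV[R]_n) : dotv 0 u = 0.
Proof. by rewrite dotvC dotv0r. Qed.

Lemma dotv_trmx n m (A : 'M[R]_(n, m)) u v :
  dotv u (A *m v) = dotv (A^T *m u) v.
Proof. by rewrite /dotv trmx_mul trmxK mulmxA. Qed.

Lemma dotv_ge0 n (u : 'cV[R]_n) : 0 <= dotv u u.
Proof. by rewrite dotvE sumr_ge0// => i _; rewrite -expr2 sqr_ge0. Qed.

Lemma dotv_eq0 n (u : 'cV[R]_n) : dotv u u = 0 -> u = 0.
Proof.
rewrite dotvE => /eqP; rewrite psumr_eq0; last by move=> i _; rewrite -expr2 sqr_ge0.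
move=> /allP u0; apply/matrixP => i j; rewrite ord1 mxE.
by have /(_ (mem_index_enum i)) := u0 i; rewrite /= mulf_eq0 orbb => /eqP.
Qed.

Lemma enorm_ge0 n (u : 'cV[R]_n) : 0 <= enorm u.
Proof. exact: sqrtr_ge0. Qed.

Lemma enorm_sqr n (u : 'cV[R]_n) : enorm u ^+ 2 = dotv u u.
Proof. by rewrite sqr_sqrtr// dotv_ge0. Qed.

Lemma enormZ n a (u : 'cV[R]_n) : enorm (a *: u) = `|a| * enorm u.
Proof. by rewrite /enorm dotvZl dotvZr mulrA -expr2 sqrtrM ?sqr_ge0// sqrtr_sqr. Qed.

Lemma enorm0 n : enorm (0 : 'cV[R]_n) = 0.
Proof. by rewrite /enorm dotv0r sqrtr0. Qed.

Lemma enorm_eq0 n (u : 'cV[R]_n) : enorm u = 0 -> u = 0.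
Proof. by move=> u0; apply: dotv_eq0; rewrite -enorm_sqr u0 expr0n. Qed.

Lemma cauchy_schwarz n (u v : 'cV[R]_n) :
  dotv u v ^+ 2 <= dotv u u * dotv v v.
Proof.
have [v0|v0] := eqVneq (dotv v v) 0.
  by rewrite (dotv_eq0 v0) !dotv0r expr0n mulr0.
have vgt0 : 0 < dotv v v by rewrite lt0r v0 dotv_ge0.
have := dotv_ge0 (dotv v v *: u - dotv u v *: v).
rewrite dotvBl !dotvBr !dotvZl !dotvZr (dotvC v u).
rewrite (_ : _ - _ = dotv v v * (dotv u u * dotv v v - dotv u v ^+ 2)).
  by rewrite pmulr_rge0// subr_ge0.
by ring.
Qed.

Lemma norm_dotv_le n (u v : 'cV[R]_n) : `|dotv u v| <= enorm u * enorm v.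
Proof.
by rewrite -sqrtr_sqr /enorm -sqrtrM ?dotv_ge0// ler_wsqrtr// cauchy_schwarz.
Qed.

Lemma dotv_le_enorm n (u v : 'cV[R]_n) : dotv u v <= enorm u * enorm v.
Proof. exact: ler_normlW (norm_dotv_le u v). Qed.

Lemma enormD n (u v : 'cV[R]_n) : enorm (u + v) <= enorm u + enorm v.
Proof.
rewrite -(@ler_pXn2r _ 2)// ?nnegrE ?addr_ge0 ?enorm_ge0//.
rewrite enorm_sqr sqrrD !enorm_sqr dotvDl !dotvDr (dotvC v u).
by have := dotv_le_enorm u v; lra.
Qed.

Definition frobenius_sqr n m (A : 'M[R]_(n, m)) : R := \sum_i \sum_j A i j ^+ 2.

Lemma frobenius_sqr_ge0 n m (A : 'M[R]_(n, m)) : 0 <= frobenius_sqr A.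
Proof. by apply: sumr_ge0 => i _; apply: sumr_ge0 => j _; rewrite sqr_ge0. Qed.

Lemma dotv_mulmx_frobenius_sqr n m (A : 'M[R]_(n, m)) u :
  dotv (A *m u) (A *m u) <= frobenius_sqr A * dotv u u.
Proof.
rewrite dotvE mulr_suml; apply: ler_sum => i _; rewrite -expr2.
have := cauchy_schwarz (row i A)^T u.
rewrite [X in X ^+ 2](_ : _ = (A *m u) i 0); last first.
  by rewrite dotvE mxE; apply: eq_bigr => j _; rewrite !mxE.
rewrite [X in X * _](_ : _ = \sum_j A i j ^+ 2)//.
by rewrite dotvE; apply: eq_bigr => j _; rewrite !mxE expr2.
Qed.

Lemma enorm_mulmx_frobenius_sqr n m (A : 'M[R]_(n, m)) u :
  enorm (A *m u) <= Num.sqrt (frobenius_sqr A) * enorm u.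
Proof.
by rewrite /enorm -sqrtrM ?frobenius_sqr_ge0// ler_wsqrtr// dotv_mulmx_frobenius_sqr.
Qed.

Lemma enorm_unit_frobenius_sqr n m (A : 'M[R]_(n, m)) u :
  enorm u <= 1 -> enorm (A *m u) <= Num.sqrt (frobenius_sqr A).
Proof.
move=> u1; apply: (le_trans (enorm_mulmx_frobenius_sqr _ _)).
by rewrite ler_piMr// sqrtr_ge0.
Qed.

Lemma opnorm_has_sup n m (A : 'M[R]_(n, m)) :
  has_sup [set enorm (A *m u) | u in [set u | enorm u <= 1]].
Proof.
split; first by exists (enorm (A *m 0)), 0; rewrite //= enorm0 ler01.
by exists (Num.sqrt (frobenius_sqr A)) => _ [u /= u1 <-]; exact: enorm_unit_frobenius_sqr.
Qed.

Lemma enorm_unit_opnorm n m (A : 'M[R]_(n, m)) u :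
  enorm u <= 1 -> enorm (A *m u) <= opnorm A.
Proof.
by move=> u1; apply: ub_le_sup; [exact: (opnorm_has_sup A).2|exists u].
Qed.

Lemma enorm_mulmx_opnorm n m (A : 'M[R]_(n, m)) u :
  enorm (A *m u) <= opnorm A * enorm u.
Proof.
have [u0|u0] := eqVneq (enorm u) 0.
  by rewrite u0 (enorm_eq0 u0) mulmx0 enorm0 mulr0.
have ugt0 : 0 < enorm u by rewrite lt0r u0 enorm_ge0.
rewrite -ler_pdivrMr// mulrC.
rewrite -{1}(@gtr0_norm _ (enorm u)^-1) ?invr_gt0// -enormZ scalemxAr.
apply: enorm_unit_opnorm; rewrite enormZ gtr0_norm ?invr_gt0//.
by rewrite mulVf.
Qed.

Lemma opnorm_le n m (A B : 'M[R]_(n, m)) :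
  opnorm A <= opnorm B + Num.sqrt (frobenius_sqr (A - B)).
Proof.
apply: ge_sup; first exact: (opnorm_has_sup A).1.
move=> _ [u /= u1 <-]; rewrite -[A in A *m u](subrK B) addrC mulmxDl.
apply: (le_trans (enormD _ _)); apply: lerD.
  exact: enorm_unit_opnorm.
exact: enorm_unit_frobenius_sqr.
Qed.

Lemma frobenius_sqrN n m (A : 'M[R]_(n, m)) : frobenius_sqr (- A) = frobenius_sqr A.
Proof.
by apply: eq_bigr => i _; apply: eq_bigr => j _; rewrite mxE sqrrN.
Qed.

(** This is what makes the operator norm of a random matrix a random variable. *)
Lemma opnorm_lipschitz n m (A B : 'M[R]_(n, m)) :
  (opnorm A - opnorm B) ^+ 2 <= frobenius_sqr (A - B).
Proof.
rewrite -(sqr_sqrtr (frobenius_sqr_ge0 (A - B))) -real_normK ?num_real//.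
rewrite ler_pXn2r ?nnegrE ?sqrtr_ge0// ler_norml.
have := opnorm_le A B; have := opnorm_le B A.
rewrite -opprB frobenius_sqrN; lra.
Qed.

End EuclideanTheory.

Section Symmetric.
Context {R : realType} (m : nat).
Implicit Types (A B U V : 'M[R]_m) (D E : 'rV[R]_m).

Lemma dotv_scalar_mx a (u : 'cV[R]_m) : dotv u (a%:M *m u) = a * dotv u u.
Proof. by rewrite mul_scalar_mx dotvZr. Qed.

(** This is A^2 <= M2 A, and it needs no diagonalization: expand the nonnegative
    quadratic form of A at g - A g / M2. *)
Lemma dotv_sym_sqr_le M1 M2 A g : 0 < M1 -> 0 < M2 ->
  sym_between M1 M2 A ->
  dotv (A *m g) (A *m g) <= M2 * dotv g (A *m g).
Proof.
move=> M1_gt0 M2_gt0 [AT lo hi].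
have pos u : 0 <= dotv u (A *m u).
  apply: le_trans (lo u); rewrite dotv_scalar_mx.
  by rewrite mulr_ge0 ?dotv_ge0// ltW.
have := pos (g - M2^-1 *: (A *m g)).
have := hi (A *m g); rewrite dotv_scalar_mx.
set q := dotv (A *m g) (A *m (A *m g)); set r := dotv (A *m g) (A *m g) => qr.
rewrite mulmxBr -scalemxAr !dotvBl !dotvBr !dotvZl !dotvZr -/q.
rewrite (_ : dotv g (A *m (A *m g)) = r); last by rewrite dotv_trmx AT.
rewrite (_ : dotv (A *m g) (A *m g) = r)// => H.
have : M2^-1 * (M2^-1 * q) <= M2^-1 * r.
  by rewrite ler_wpM2l ?invr_ge0 ?(ltW M2_gt0)// ler_pdivrMl.
move=> H'.
rewrite -ler_pdivrMl//; lra.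
Qed.

Definition clip (M1 M2 t : R) : R := Num.max M1 (Num.min t M2).

Lemma clip_between M1 M2 t : M1 <= M2 -> M1 <= clip M1 M2 t <= M2.
Proof.
move=> M12; rewrite /clip le_max lexx/= ge_max M12/=.
by rewrite ge_min lexx orbT.
Qed.

Lemma clip_lipschitz M1 M2 s t : M1 <= M2 ->
  (clip M1 M2 s - clip M1 M2 t) ^+ 2 <= (s - t) ^+ 2.
Proof.
move=> M12.
have mono a b : a <= b -> 0 <= clip M1 M2 b - clip M1 M2 a <= b - a.
  move=> ab; rewrite /clip.
  case: (leP a M2) => aM2; case: (leP b M2) => bM2.
  - by case: (leP M1 a) => aM1; case: (leP M1 b) => bM1; lra.
  - by rewrite (max_r M12); case: (leP M1 a) => aM1; lra.
  - by lra.
  - by lra.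
have [st|/ltW ts] := leP s t.
  have /andP[? ?] := mono _ _ st.
  by rewrite -sqrrN opprB -[leRHS]sqrrN opprB ler_pXn2r// nnegrE; lra.
by have /andP[? ?] := mono _ _ ts; rewrite ler_pXn2r// nnegrE; lra.
Qed.

Lemma dotv_diag_mx D (u : 'cV[R]_m) :
  dotv u (diag_mx D *m u) = \sum_i D 0 i * u i 0 ^+ 2.
Proof.
rewrite dotvE; apply: eq_bigr => i _; rewrite mul_diag_mx mxE.
by rewrite mulrCA -expr2.
Qed.

Lemma eigen_clip_between M1 M2 A B : M1 <= M2 -> eigen_clip M1 M2 A B ->
  sym_between M1 M2 B.
Proof.
move=> M12 [U [D [UU _ ->]]].
have UU' : U *m U^T = 1%:M by exact: mulmx1C.
have dU (u : 'cV[R]_m) : dotv u u = \sum_i (U^T *m u) i 0 ^+ 2.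
  rewrite -[u in X in dotv _ X]mul1mx -UU' -mulmxA dotv_trmx dotvE.
  by apply: eq_bigr => i _; rewrite -expr2.
have qU (u : 'cV[R]_m) E :
    dotv u (U *m diag_mx E *m U^T *m u) = \sum_i E 0 i * (U^T *m u) i 0 ^+ 2.
  by rewrite -!mulmxA dotv_trmx dotv_diag_mx.
split.
- by rewrite !trmx_mul trmxK tr_diag_mx mulmxA.
- move=> u; rewrite qU dotv_scalar_mx dU mulr_sumr; apply: ler_sum => i _.
  by rewrite ler_wpM2r ?sqr_ge0// mxE; case/andP: (clip_between (D 0 i) M12).
- move=> u; rewrite qU dotv_scalar_mx dU mulr_sumr; apply: ler_sum => i _.
  by rewrite ler_wpM2r ?sqr_ge0// mxE; case/andP: (clip_between (D 0 i) M12).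
Qed.

Lemma frobenius_sqr_tr n p (A : 'M[R]_(n, p)) : frobenius_sqr A = \tr (A^T *m A).
Proof.
rewrite /frobenius_sqr exchange_big/=; apply: eq_bigr => j _; rewrite mxE.
by apply: eq_bigr => i _; rewrite mxE expr2.
Qed.

Lemma frobenius_sqr_orthoMl U A : U^T *m U = 1%:M ->
  frobenius_sqr (U *m A) = frobenius_sqr A.
Proof.
by move=> UU; rewrite !frobenius_sqr_tr trmx_mul -mulmxA (mulmxA U^T) UU mul1mx.
Qed.

Lemma frobenius_sqr_orthoMr V A : V *m V^T = 1%:M ->
  frobenius_sqr (A *m V) = frobenius_sqr A.
Proof.
move=> VV; rewrite !frobenius_sqr_tr mxtrace_mulC trmx_mul mulmxA -(mulmxA A) VV mulmx1.
by rewrite mxtrace_mulC.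
Qed.

(** In the two eigenbases, the entries of the difference of two symmetric
    matrices are (d_i - e_j) w_ij, where w is the orthogonal change of basis. *)
Lemma frobenius_sqr_spectral_sub U V D E : U^T *m U = 1%:M -> V^T *m V = 1%:M ->
  frobenius_sqr (U *m diag_mx D *m U^T - V *m diag_mx E *m V^T) =
  \sum_i \sum_j ((D 0 i - E 0 j) * (U^T *m V) i j) ^+ 2.
Proof.
move=> UU VV; have VV' : V *m V^T = 1%:M by exact: mulmx1C.
have UU' : U *m U^T = 1%:M by exact: mulmx1C.
rewrite -(@frobenius_sqr_orthoMl U^T) ?trmxK// -(@frobenius_sqr_orthoMr V)//.
rewrite mulmxBr mulmxBl !mulmxA UU mul1mx -!mulmxA VV mulmx1 (mulmxA _ _ (diag_mx E)).
apply: eq_bigr => i _; apply: eq_bigr => j _; congr (_ ^+ 2).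
rewrite mxE mul_diag_mx [X in _ + X]mxE mul_mx_diag !mxE.
by rewrite mulrBl mulrC [X in _ - X]mulrC mulrC.
Qed.

(** Truncation is a 1-Lipschitz function of a scalar, so each term of
    [frobenius_sqr_spectral_sub] decreases. The point is that the truncated
    matrix, which [eigen_clip] only constrains by a relation, is a continuous
    function of the original one: this is what makes H_(k+1) measurable. *)
Lemma eigen_clip_lipschitz M1 M2 A B A' B' : M1 <= M2 ->
  eigen_clip M1 M2 A B -> eigen_clip M1 M2 A' B' ->
  frobenius_sqr (B - B') <= frobenius_sqr (A - A').
Proof.
move=> M12 [U [D [UU -> ->]]] [V [E [VV -> ->]]].
rewrite !frobenius_sqr_spectral_sub//; apply: ler_sum => i _; apply: ler_sum => j _.
by rewrite !exprMn ler_wpM2r ?sqr_ge0// !mxE clip_lipschitz.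
Qed.

End Symmetric.

(** * Smooth convex functions *)

Section Gradient.
Context {R : realType} (n : nat).
Implicit Types (f : 'cV[R]_n -> R).

Lemma derive_grad f x v : differentiable f x -> 'D_v f x = dotv (grad f x) v.
Proof.
move=> df; rewrite deriveE// dotvE.
have {1}-> : v = \sum_i v i 0 *: delta_mx i 0.
  rewrite [LHS]matrix_sum_delta; apply: eq_bigr => i _.
  by rewrite (bigD1 ord0)//= big1 ?addr0// => j; rewrite ord1 eqxx.
rewrite linear_sum; apply: eq_bigr => i _.
by rewrite linearZ/= mxE deriveE// mulrC.
Qed.

(** The two directional derivatives are limits of the same difference quotient. *)
Lemma derive_affine m f (x : 'cV[R]_n) (P : 'M[R]_(n, m)) u v :
  'D_v (fun u => f (x + P *m u)) u = 'D_(P *m v) f (x + P *m u).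
Proof.
have E : (fun h : R => h^-1 *: (((fun u => f (x + P *m u)) \o shift u) (h *: v)
      - f (x + P *m u))) =
    (fun h : R => h^-1 *: ((f \o shift (x + P *m u)) (h *: (P *m v))
      - f (x + P *m u))).
  by apply/funext => h /=; rewrite mulmxDr -scalemxAr addrCA.
by rewrite /derive E.
Qed.

Lemma grad_affine m f (x : 'cV[R]_n) (P : 'M[R]_(n, m)) u :
  differentiable f (x + P *m u) ->
  grad (fun u => f (x + P *m u)) u = P^T *m grad f (x + P *m u).
Proof.
move=> df; apply/matrixP => i j; rewrite ord1 mxE derive_affine derive_grad//.
rewrite dotvC dotvE mxE; apply: eq_bigr => l _; rewrite !mxE; congr (_ * _).
rewrite (bigD1 i)//= big1 ?addr0 ?mxE ?eqxx ?mulr1// => k /negPf ki.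
by rewrite mxE ki mulr0.
Qed.

Lemma is_derive_line f (x v : 'cV[R]_n) (t : R) :
  differentiable f (x + t *: v) ->
  is_derive t (1 : R) (fun t : R => f (x + t *: v)) (dotv (grad f (x + t *: v)) v).
Proof.
move=> df.
have E : (fun h : R => h^-1 *: (((fun t : R => f (x + t *: v)) \o shift t)
      (h *: (1 : R)) - f (x + t *: v))) =
    (fun h : R => h^-1 *: ((f \o shift (x + t *: v)) (h *: v) - f (x + t *: v))).
  apply/funext => h /=; congr (_ *: (f _ - _)).
  by rewrite scalerDl addrCA /GRing.scale/= mulr1.
split.
- by rewrite /derivable E; exact: diff_derivable.
- by rewrite -derive_grad// /derive E.
Qed.

Section Smooth.
Variables (f : 'cV[R]_n -> R) (L : R).
Hypothesis df : forall x, differentiable f x.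
Hypothesis L_ge0 : 0 <= L.
Hypothesis f_smooth : forall u v, enorm (grad f u - grad f v) <= L * enorm (u - v).

Lemma grad_increment_le x v (t : R) : 0 <= t ->
  `|dotv (grad f (x + t *: v) - grad f x) v| <= L * t * dotv v v.
Proof.
move=> t0; apply: (le_trans (norm_dotv_le _ _)).
rewrite -[dotv v v]enorm_sqr expr2 mulrA ler_wpM2r ?enorm_ge0//.
apply: (le_trans (f_smooth _ _)).
by rewrite addrAC subrr add0r enormZ ger0_norm// mulrA.
Qed.

(** Along the segment, subtracting from f its first-order expansion and the
    quadratic term leaves a function of nonpositive derivative; the mean value
    theorem compares its values at 0 and 1. *)
Lemma descent_lemma x v :
  f (x + v) <= f x + dotv (grad f x) v + L / 2 * dotv v v.
Proof.
pose psi (t : R) := f (x + t *: v) - t * dotv (grad f x) v - t ^+ 2 * (L / 2 * dotv v v).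
pose dpsi (t : R) := dotv (grad f (x + t *: v)) v - dotv (grad f x) v - L * t * dotv v v.
have dp (t : R) : is_derive t (1 : R) psi (dpsi t).
  have := is_derive_line (df (x + t *: v)) => H.
  rewrite /psi/dpsi; apply: is_derive_eq; rewrite /GRing.scale/=.
  by field.
have [|t] := MVT ltr01 (fun t _ => dp t).
  apply: derivable_within_continuous => t _; exact: (@ex_derive _ _ _ _ _ _ _ (dp t)).
rewrite in_itv/= => /andP[t0 t1] E.
have : dpsi t <= 0.
  have := ler_normlW (grad_increment_le x v (ltW t0)); rewrite dotvBl /dpsi; lra.
move: E; rewrite /psi scale1r scale0r addr0; lra.
Qed.

(** The descent lemma from x + t v back to x; the constant 3/2 is 1/2 plus the cost
    of replacing the gradient at x + t v by the gradient at x. *)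
Lemma grad_lower x v (t : R) : 0 <= t ->
  f x + t * dotv (grad f x) v - 3 / 2 * L * t ^+ 2 * dotv v v <= f (x + t *: v).
Proof.
move=> t0; have := descent_lemma (x + t *: v) (- (t *: v)).
rewrite addrK !dotvNr dotvNl opprK !dotvZr dotvZl.
have := grad_increment_le x (t *: v) ler01.
rewrite scale1r dotvBl !dotvZr dotvZl ler_norml => /andP[].
move: (f x) (f (x + t *: v)) => A B; lra.
Qed.

(** Divide the convexity inequality at x + t (y - x) by t and let t tend to 0; the
    error is linear in t by [grad_lower]. *)
Lemma dotv_grad_le_sub x y : convex_function [set: 'cV[R]_n] f ->
  dotv (grad f x) (y - x) <= f y - f x.
Proof.
move=> cf; set v := y - x.
have key (t : R) : 0 < t -> t <= 1 ->
    dotv (grad f x) v <= f y - f x + 3 / 2 * L * dotv v v * t.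
  move=> t0 t1.
  pose t' := Itv01 (ltW t0) t1.
  have := cf t' y x; rewrite !inE => /(_ I I).
  have -> : conv t' (y : convex_lmodType 'cV[R]_n) (x : convex_lmodType _) = x + t *: v.
    rewrite /conv/= /v scalerBr scalerBl scale1r.
    by rewrite addrC -addrA; congr (_ + _); rewrite addrC.
  rewrite convRE/= => fc.
  have := grad_lower x v (ltW t0) => gl.
  have : t * dotv (grad f x) v <= t * (f y - f x + 3 / 2 * L * dotv v v * t).
    by move: fc; rewrite /unstable.onem; lra.
  by rewrite ler_pM2l.
apply/ler_addgt0Pr => e e0.
set K := 3 / 2 * L * dotv v v in key.
have K0 : 0 <= K by rewrite mulr_ge0 ?dotv_ge0// mulr_ge0//; lra.
pose t := Num.min 1 (e / (K + 1)).
have t0 : 0 < t by rewrite lt_min ltr01 divr_gt0//; lra.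
apply: (le_trans (key t t0 _)); first by rewrite ge_min lexx.
rewrite lerD2l; apply: (@le_trans _ _ (K * (e / (K + 1)))).
  by rewrite ler_wpM2l// ge_min lexx orbT.
by rewrite mulrCA ler_piMr ?(ltW e0)// ler_pdivrMr; lra.
Qed.

(** Otherwise a gradient step of length 1/L from z would decrease f. *)
Lemma grad_solution z : 0 < L -> solutions f z -> grad f z = 0.
Proof.
move=> L0 zmin; apply: dotv_eq0.
have := descent_lemma z (- (L^-1 *: grad f z)).
have := zmin (z - L^-1 *: grad f z).
rewrite !dotvNr dotvNl opprK !dotvZr dotvZl.
have := dotv_ge0 (grad f z); set q := dotv _ _ => q0 H1 H2.
have : L^-1 * q <= L / 2 * (L^-1 * (L^-1 * q)) by lra.
rewrite (_ : L / 2 * _ = L^-1 * (q / 2)); last by field; rewrite gt_eqF.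
rewrite ler_pM2l ?invr_gt0//; lra.
Qed.

Lemma gap_le_sqr_dist x z : 0 < L -> solutions f z ->
  f x - f z <= L / 2 * enorm (x - z) ^+ 2.
Proof.
move=> L0 zmin; have := descent_lemma z (x - z).
by rewrite addrC subrK grad_solution// dotv0l enorm_sqr; lra.
Qed.

End Smooth.
End Gradient.

(** * One run of the algorithm *)

Section SubspaceMatrix.
Context {R : realType} (n d m : nat).

Lemma dotv_normalize_le1 (u : 'cV[R]_n) : dotv (normalize u) (normalize u) <= 1.
Proof.
rewrite dotvZl dotvZr -enorm_sqr.
have [->|u0] := eqVneq (enorm u) 0; first by rewrite invr0 mul0r ler01.
by rewrite expr2 mulKf// mulVf.
Qed.

Lemma col_drop2_append (A : 'M[R]_(n, m)) (u v : 'cV[R]_n) j :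
  col j (drop2_append A u v) =
  if insub j.+2 is Some j' then col j' A else if j.+2 == m then u else v.
Proof.
apply/matrixP => i l; rewrite !mxE ord1.
by case: insubP => [j' _ _|_]; [rewrite mxE|case: ifP].
Qed.

Lemma subspace_mx_col_le1 f (Pinit : 'M[R]_(n, m)) (Q : nat -> 'M[R]_(n, d)) x k j :
  (forall j, enorm (col j Pinit) = 1) ->
  dotv (col j (subspace_mx f Pinit Q x k)) (col j (subspace_mx f Pinit Q x k))
    <= 1.
Proof.
move=> P1; have initle1 j' : dotv (col j' Pinit) (col j' Pinit) <= 1.
  by rewrite -enorm_sqr P1 expr1n.
by elim: k j => [|k IH] j /=; rewrite col_drop2_append; case: insubP => [j' _ _|_];
  rewrite ?IH ?initle1//; case: ifP => _; exact: dotv_normalize_le1.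
Qed.

(** The subspace always contains the current sketched gradient, whatever the older
    columns are: the decrease obtained at step k comes from this column only. *)
Lemma subspace_mx_last_col f (Pinit : 'M[R]_(n, m)) (Q : nat -> 'M[R]_(n, d)) x k :
  (0 < m)%N ->
  exists j, col j (subspace_mx f Pinit Q x k) =
            normalize (sketched_grad f (Q k) (x k)).
Proof.
move=> m0; have hj : (m.-1 < m)%N by rewrite prednK.
exists (Ordinal hj); case: k => [|k] /=; rewrite col_drop2_append;
  by case: insubP => [j' /=|_ /=]; rewrite prednK// ?ltnNge ?leqnSn// gtn_eqF.
Qed.

Lemma frobenius_sqr_col_le1 (P : 'M[R]_(n, m)) :
  (forall j, dotv (col j P) (col j P) <= 1) -> frobenius_sqr P <= m%:R.
Proof.
move=> Pj; rewrite /frobenius_sqr exchange_big/=.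
have -> : m%:R = \sum_(j < m) (1 : R) by rewrite sumr_const card_ord.
apply: ler_sum => j _; apply: le_trans (Pj j).
by rewrite dotvE; apply: ler_sum => i _; rewrite mxE expr2.
Qed.

Lemma dotv_col_sqr_le (P : 'M[R]_(n, m)) j v :
  dotv (col j P) v ^+ 2 <= dotv (P^T *m v) (P^T *m v).
Proof.
rewrite [leRHS]dotvE (bigD1 j)//= -expr2.
rewrite (_ : (P^T *m v) j 0 = dotv (col j P) v).
  by rewrite lerDl sumr_ge0// => i _; rewrite -expr2 sqr_ge0.
by rewrite dotvE mxE; apply: eq_bigr => i _; rewrite !mxE.
Qed.

(** The bound on Q Q^T v follows from one on the operator norm of Q Q^T, but is
    polynomial in the entries of Q and v: the event is jointly measurable in the
    sketch and the gradient. *)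
Definition good_sketch (a b : R) (Q : 'M[R]_(n, d)) (v : 'cV[R]_n) : Prop :=
  a * dotv v v <= dotv (Q^T *m v) (Q^T *m v) /\
  dotv (Q *m Q^T *m v) (Q *m Q^T *m v) <= b ^+ 2 * dotv v v.

(** The cosine of the angle between v and Q Q^T v is
    |Q^T v|^2 / (|v| |Q Q^T v|), and the two bounds make it at least a / b. *)
Lemma good_sketch_correlation a b (Q : 'M[R]_(n, d)) v : 0 < a -> 0 < b ->
  good_sketch a b Q v ->
  (a / b) ^+ 2 * dotv v v <= dotv (normalize (Q *m Q^T *m v)) v ^+ 2.
Proof.
move=> a0 b0 [lo hi].
have [v0|v0] := eqVneq (dotv v v) 0; first by rewrite v0 mulr0 sqr_ge0.
have vv0 : 0 < dotv v v by rewrite lt0r v0 dotv_ge0.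
have qv : dotv (Q *m Q^T *m v) v = dotv (Q^T *m v) (Q^T *m v).
  by rewrite -mulmxA dotvC dotv_trmx.
have s0 : 0 < enorm (Q *m Q^T *m v).
  rewrite lt0r enorm_ge0 andbT; apply/eqP => /enorm_eq0 q0.
  by move: lo; rewrite -qv q0 dotv0l leNgt mulr_gt0.
rewrite /normalize dotvZl qv [leRHS]exprMn [in leRHS]exprVn.
rewrite ler_pdivlMl ?exprn_gt0// enorm_sqr.
set s := dotv (Q *m Q^T *m v) _ in hi *; set t := dotv (Q^T *m v) _ in lo *.
set q := dotv v v in hi lo vv0 *.
have : s * ((a / b) ^+ 2 * q) <= (b ^+ 2 * q) * ((a / b) ^+ 2 * q).
  by rewrite ler_wpM2r// mulr_ge0 ?sqr_ge0// ltW.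
move=> /le_trans; apply.
rewrite (_ : _ * _ = (a * q) ^+ 2); last by field; rewrite gt_eqF.
by rewrite ler_pXn2r// nnegrE ?dotv_ge0// mulr_ge0// ltW.
Qed.

End SubspaceMatrix.

Section Step.
Context {R : realType} (n m : nat).
Variables (f : 'cV[R]_n -> R) (beta c M1 M2 L : R).
Hypothesis df : forall x, differentiable f x.
Hypothesis hbeta : 0 < beta < 1.
Hypothesis hc : 0 < c < 1.
Hypothesis hM : 0 < M1 <= M2.
Hypothesis hL : 0 < L.
Hypothesis m_gt0 : (0 < m)%N.
Hypothesis f_smooth : forall u v, enorm (grad f u - grad f v) <= L * enorm (u - v).

Let M1_gt0 : 0 < M1. Proof. by case/andP: hM. Qed.
Let M2_gt0 : 0 < M2. Proof. by case/andP: hM => ? /(lt_le_trans _); apply. Qed.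

Lemma step_lower_bound_gt0 : 0 < step_lower_bound m beta c M2 L.
Proof.
rewrite /step_lower_bound lt_min ltr01/= divr_gt0 ?mulr_gt0 ?ltr0n//.
- by case/andP: hbeta.
- by case/andP: hc; rewrite subr_gt0.
Qed.

(** Write D for <g, H g>. Since the columns of P have norm at most 1,
    |P H g|^2 <= m |H g|^2 <= m M2 D, so the second-order term of the descent lemma
    is at most L a^2 m M2 D / 2, and this is at most (1 - c) a D for such a. *)
Lemma small_step_armijo x (P : 'M[R]_(n, m)) (H : 'M[R]_m) (a : R) :
  frobenius_sqr P <= m%:R -> sym_between M1 M2 H ->
  let g := P^T *m grad f x in
  0 < a -> a <= 2 * (1 - c) / (m%:R * M2 * L) ->
  f (x + a *: (P *m - (H *m g))) <= f x + c * a * dotv g (- (H *m g)).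
Proof.
move=> Pm HM g a0 ale.
apply: (le_trans (descent_lemma df f_smooth _ _)).
rewrite -addrA lerD2l !dotvZl !dotvZr dotv_trmx -/g dotvNr mulmxN dotvNr dotvNl opprK.
have PH : dotv (P *m (H *m g)) (P *m (H *m g)) <= m%:R * (M2 * dotv g (H *m g)).
  apply: (le_trans (dotv_mulmx_frobenius_sqr _ _)).
  apply: ler_pM; rewrite ?frobenius_sqr_ge0 ?dotv_ge0//.
  exact: (@dotv_sym_sqr_le _ _ M1).
have D0 : 0 <= dotv g (H *m g).
  case: HM => _ /(_ g) + _; rewrite dotv_scalar_mx; apply: le_trans.
  by rewrite mulr_ge0 ?dotv_ge0// ltW.
move: PH D0; set D := dotv g _; set S := dotv _ _ => PH D0.
have mML : 0 < m%:R * M2 * L by rewrite !mulr_gt0// ltr0n.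
move: ale; rewrite ler_pdivlMr// => ale.
have h1 : L / 2 * (a * (a * S)) <= L / 2 * (a * (a * (m%:R * (M2 * D)))).
  by rewrite ler_wpM2l ?divr_ge0 ?(ltW hL)// !(ler_wpM2l (ltW a0)).
have h2 : a * D / 2 * (a * (m%:R * M2 * L)) <= a * D / 2 * (2 * (1 - c)).
  by rewrite ler_wpM2l// divr_ge0// mulr_ge0// ltW.
move: (m%:R) h1 h2 => mm; lra.
Qed.

(** Backtracking stops at once or after a rejected step, which must exceed the
    threshold kappa below which every step is accepted. *)
Lemma backtracking_lower_bound (A : R -> Prop) kappa i :
  (forall a, 0 < a -> a <= kappa -> A a) ->
  (forall j, (j < i)%N -> ~ A (beta ^+ j)) ->
  Num.min 1 (beta * kappa) <= beta ^+ i.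
Proof.
move=> Asmall; case: i => [|i] Amin; first by rewrite expr0 ge_min lexx.
rewrite ge_min exprS; apply/orP; right.
case/andP: hbeta => b0 _; rewrite ler_wpM2l ?(ltW b0)// leNgt.
apply/negP => lt; apply: (Amin i) => //.
by apply: Asmall; rewrite ?exprn_gt0// ltW.
Qed.

End Step.

Section Path.
Context {R : realType} (n d m : nat).
Variables (f : 'cV[R]_n -> R) (beta c M1 M2 L : R).
Hypothesis df : forall x, differentiable f x.
Hypothesis hbeta : 0 < beta < 1.
Hypothesis hc : 0 < c < 1.
Hypothesis hM : 0 < M1 <= M2.
Hypothesis hL : 0 < L.
Hypothesis m_gt0 : (0 < m)%N.
Hypothesis f_smooth : forall u v, enorm (grad f u - grad f v) <= L * enorm (u - v).
Variables (x0 : 'cV[R]_n) (H0 : 'M[R]_m) (Pinit : 'M[R]_(n, m)).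
Hypothesis hH0 : sym_between M1 M2 H0.
Hypothesis hPinit : forall j, enorm (col j Pinit) = 1.
Variables (Q : nat -> 'M[R]_(n, d)) (Hdeg : nat -> 'M[R]_m).
Variables (x : nat -> 'cV[R]_n) (H : nat -> 'M[R]_m) (alpha : nat -> R).
Hypothesis Hdeg_bounds : forall k, sym_between M1 M2 (Hdeg k).
Hypothesis run : subspace_qn_path f beta c M1 M2 x0 H0 Pinit Q Hdeg x H alpha.

Let M1_gt0 : 0 < M1. Proof. by case/andP: hM. Qed.
Let c_gt0 : 0 < c. Proof. by case/andP: hc. Qed.
Let abar_gt0 : 0 < step_lower_bound m beta c M2 L.
Proof. exact: (step_lower_bound_gt0 hbeta hc hM). Qed.

Lemma path_sym_between k : sym_between M1 M2 (H k).
Proof.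
case: k => [|k]; first by rewrite (path_H0 run).
have [_ _] := path_step run k; case: ifP => _; first by move=> ->.
by apply: eigen_clip_between; case/andP: hM.
Qed.

(** The accepted step is at least [step_lower_bound], and the Armijo condition
    gives a decrease of c alpha <g, H g>, where H >= M1. *)
Lemma path_decrease k :
  f (x k.+1) <= f (x k) - c * step_lower_bound m beta c M2 L * M1
    * dotv ((subspace_mx f Pinit Q x k)^T *m grad f (x k))
           ((subspace_mx f Pinit Q x k)^T *m grad f (x k)).
Proof.
set P := subspace_mx _ _ _ _ _; set g := _ *m grad f (x k); have /= := path_step run k.
rewrite grad_affine// !mulmx0 !addr0 -/g => -[[i [-> armijo minimal]] -> _].
apply: (le_trans armijo).
rewrite lerD2l dotvNr mulrN lerN2 -!mulrA ler_wpM2l ?(ltW c_gt0)//.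
have abar : step_lower_bound m beta c M2 L <= beta ^+ i.
  have -> : step_lower_bound m beta c M2 L =
      Num.min 1 (beta * (2 * (1 - c) / (m%:R * M2 * L))).
    by rewrite /step_lower_bound !mulrA (mulrC beta).
  pose A (a : R) : Prop := f (x k + a *: (P *m - (H k *m g))) <=
    f (x k) + c * a * dotv g (- (H k *m g)).
  apply: (@backtracking_lower_bound _ _ hbeta A) => // a a0 ale.
  have Pm : frobenius_sqr P <= m%:R.
    by apply: frobenius_sqr_col_le1 => j; exact: subspace_mx_col_le1.
  exact: (small_step_armijo df hM hL m_gt0 f_smooth (x k) Pm (path_sym_between k)).
rewrite ler_pM ?mulr_ge0 ?dotv_ge0 ?(ltW abar_gt0) ?(ltW M1_gt0)//.
by case: (path_sym_between k) => _ /(_ g) + _; rewrite dotv_scalar_mx.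
Qed.

Lemma path_nonincreasing k : f (x k.+1) <= f (x k).
Proof.
apply: (le_trans (path_decrease k)); rewrite gerBl.
by rewrite !mulr_ge0 ?dotv_ge0 ?(ltW c_gt0) ?(ltW abar_gt0) ?(ltW M1_gt0).
Qed.

Lemma path_le_init k : f (x k) <= f x0.
Proof.
elim: k => [|k]; first by rewrite (path_x0 run).
exact/le_trans/path_nonincreasing.
Qed.

Lemma path_good_decrease k (a b : R) : 0 < a -> 0 < b ->
  good_sketch a b (Q k) (grad f (x k)) ->
  f (x k.+1) <= f (x k) - c * step_lower_bound m beta c M2 L * M1
    * ((a / b) ^+ 2 * dotv (grad f (x k)) (grad f (x k))).
Proof.
move=> a0 b0 good; apply: (le_trans (path_decrease k)).
rewrite lerD2l lerN2 ler_wpM2l//.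
  by rewrite !mulr_ge0 ?(ltW c_gt0) ?(ltW abar_gt0) ?(ltW M1_gt0).
apply: (le_trans (good_sketch_correlation a0 b0 good)).
have [j <-] := subspace_mx_last_col f Pinit Q x k m_gt0.
exact: dotv_col_sqr_le.
Qed.

End Path.

Section Gap.
Context {R : realType} (n : nat).
Variables (f : 'cV[R]_n -> R) (L : R) (x0 : 'cV[R]_n) (R0 : R).
Hypothesis df : forall x, differentiable f x.
Hypothesis hL : 0 < L.
Hypothesis f_smooth : forall u v, enorm (grad f u - grad f v) <= L * enorm (u - v).
Hypothesis f_convex : convex_function [set: 'cV[R]_n] f.
Hypothesis hR0 : level_radius f x0 = R0%:E.

(** The distance to the solution set is an infimum, so a solution realizes it only
    up to e; finiteness of the level radius is what makes a solution exist. *)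
Lemma solution_near x e : f x <= f x0 -> 0 < e ->
  exists2 z, solutions f z & enorm (x - z) < R0 + e.
Proof.
move=> xx0 e0.
have : (ereal_inf [set (enorm (x - z))%:E | z in solutions f] < (R0 + e)%:E)%E.
  apply: (@le_lt_trans _ _ R0%:E); last by rewrite lte_fin ltrDl.
  by rewrite -hR0; apply: ereal_sup_ubound; exists x.
by move=> /ereal_inf_lt[_ [z zs <-]]; rewrite lte_fin; exists z.
Qed.

Lemma level_radius_ge0 : 0 <= R0.
Proof.
apply/ler_addgt0Pr => e e0.
have [z _ /ltW] := solution_near (lexx _) e0.
exact/le_trans/enorm_ge0.
Qed.

Lemma solution_optimal z : solutions f z -> optimal_value f = f z.
Proof.
move=> zs; apply/eqP; rewrite eq_le; apply/andP; split.
  by apply: ge_inf; [exists (f z) => _ [y _ <-]; exact: zs|exists z].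
by apply: lb_le_inf; [exists (f z), z|move=> _ [y _ <-]; exact: zs].
Qed.

Lemma gap_ge0 x : 0 <= f x - optimal_value f.
Proof.
have [z zs _] := solution_near (lexx (f x0)) ltr01.
by rewrite (solution_optimal zs) subr_ge0; exact: zs.
Qed.

(** Convexity at a solution almost realizing the distance, then
    Cauchy-Schwarz. *)
Lemma gap_le_grad x : f x <= f x0 ->
  f x - optimal_value f <= R0 * enorm (grad f x).
Proof.
move=> xx0; apply/ler_addgt0Pr => e e0.
have G0 := enorm_ge0 (grad f x).
have e'0 : 0 < e / (enorm (grad f x) + 1) by rewrite divr_gt0//; lra.
have [z zs zlt] := solution_near xx0 e'0.
rewrite (solution_optimal zs).
have := dotv_grad_le_sub df (ltW hL) f_smooth x z f_convex.
have := norm_dotv_le (grad f x) (x - z).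
rewrite -(opprB x z) dotvNr => /ler_normlW cs low.
have : enorm (grad f x) * enorm (x - z) <=
    enorm (grad f x) * (R0 + e / (enorm (grad f x) + 1)).
  by rewrite ler_wpM2l// ltW.
have : enorm (grad f x) * (e / (enorm (grad f x) + 1)) <= e.
  by rewrite mulrCA ler_piMr ?(ltW e0)// ler_pdivrMr; lra.
move: (e / _) => e'; lra.
Qed.

Lemma gap_sqr_le_grad x : f x <= f x0 ->
  (f x - optimal_value f) ^+ 2 <= R0 ^+ 2 * dotv (grad f x) (grad f x).
Proof.
move=> xx0; rewrite -enorm_sqr -exprMn ler_pXn2r ?nnegrE ?gap_ge0//.
  exact: gap_le_grad.
by rewrite mulr_ge0 ?level_radius_ge0 ?enorm_ge0.
Qed.

Lemma gap_init_le : f x0 - optimal_value f <= L / 2 * R0 ^+ 2.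
Proof.
rewrite -(@ler_pM2l _ 2)// (_ : 2 * (L / 2 * _) = L * R0 ^+ 2); last by field.
apply/ler_addgt0Pr => e e0; have R0_ge0 := level_radius_ge0.
(* For t <= 1, L (R0 + t)^2 exceeds L R0^2 by at most t L (2 R0 + 1). *)
pose t := Num.min 1 (e / (L * (2 * R0 + 1))).
have L' : 0 < L * (2 * R0 + 1) by rewrite mulr_gt0//; lra.
have t0 : 0 < t by rewrite lt_min ltr01 divr_gt0.
have t1 : t <= 1 by rewrite ge_min lexx.
have te : t * (L * (2 * R0 + 1)) <= e.
  by rewrite -ler_pdivlMr// ge_min lexx orbT.
have [z zs zlt] := solution_near (lexx _) t0.
rewrite (solution_optimal zs).
have := gap_le_sqr_dist df f_smooth x0 hL zs.
have : enorm (x0 - z) ^+ 2 <= (R0 + t) ^+ 2.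
  by rewrite ler_pXn2r ?nnegrE ?enorm_ge0 ?ltW//; lra.
move=> /(ler_wpM2l (ltW hL)).
have : L * (t * t) <= L * t by rewrite ler_wpM2l ?(ltW hL)// ler_piMr// ltW.
lra.
Qed.

End Gap.

(** * Measurability of matrix-valued functions *)

Section MatrixMeasurability.
Context {R : realType} {dT : measure_display} {T : measurableType dT}.

Definition mx_measurable p q (X : T -> 'M[R]_(p, q)) : Prop :=
  forall i j, measurable_fun [set: T] (fun w => X w i j).

Lemma measurable_inv (g : T -> R) :
  measurable_fun [set: T] g -> measurable_fun [set: T] (fun w => (g w)^-1).
Proof.
move=> mg.
(* 1 / t = t (1 / |t|)^2, also when t = 0. *)
have -> : (fun w => (g w)^-1) = (fun w => g w * (`|g w| `^ (-1)) ^+ 2).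
  apply/funext => w; rewrite powR_inv1// exprVn real_normK ?num_real//.
  by have [->|g0] := eqVneq (g w) 0; rewrite ?invr0 ?mul0r// expr2; field.
apply: measurable_funM => //; apply: measurable_funX.
by apply: measurableT_comp (@measurable_powR R (-1)) _; exact: measurableT_comp.
Qed.

Lemma mx_measurable_cst p q (A : 'M[R]_(p, q)) : mx_measurable (fun=> A).
Proof. by move=> i j; exact: measurable_cst. Qed.

Lemma mx_measurableD p q (X Y : T -> 'M[R]_(p, q)) :
  mx_measurable X -> mx_measurable Y -> mx_measurable (fun w => X w + Y w).
Proof.
move=> mX mY i j; under eq_fun do rewrite mxE.
exact: measurable_funD.
Qed.

Lemma mx_measurableN p q (X : T -> 'M[R]_(p, q)) :
  mx_measurable X -> mx_measurable (fun w => - X w).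
Proof.
by move=> mX i j; under eq_fun do rewrite mxE; exact: measurableT_comp.
Qed.

Lemma mx_measurableB p q (X Y : T -> 'M[R]_(p, q)) :
  mx_measurable X -> mx_measurable Y -> mx_measurable (fun w => X w - Y w).
Proof. by move=> mX mY; exact/mx_measurableD/mx_measurableN. Qed.

Lemma mx_measurableZ p q (g : T -> R) (X : T -> 'M[R]_(p, q)) :
  measurable_fun [set: T] g -> mx_measurable X ->
  mx_measurable (fun w => g w *: X w).
Proof.
by move=> mg mX i j; under eq_fun do rewrite mxE; exact: measurable_funM.
Qed.

Lemma mx_measurable_tr p q (X : T -> 'M[R]_(p, q)) :
  mx_measurable X -> mx_measurable (fun w => (X w)^T).
Proof. by move=> mX i j; under eq_fun do rewrite mxE; exact: mX. Qed.

Lemma mx_measurableM p q r (X : T -> 'M[R]_(p, q)) (Y : T -> 'M[R]_(q, r)) :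
  mx_measurable X -> mx_measurable Y -> mx_measurable (fun w => X w *m Y w).
Proof.
move=> mX mY i j; under eq_fun do rewrite mxE.
by apply: measurable_sum => l; exact: measurable_funM.
Qed.

Lemma measurable_dotv p (X Y : T -> 'cV[R]_p) :
  mx_measurable X -> mx_measurable Y ->
  measurable_fun [set: T] (fun w => dotv (X w) (Y w)).
Proof. by move=> mX mY; exact: (mx_measurableM (mx_measurable_tr mX) mY). Qed.

Lemma measurable_enorm p (X : T -> 'cV[R]_p) :
  mx_measurable X -> measurable_fun [set: T] (fun w => enorm (X w)).
Proof.
move=> mX; have msqrt : measurable_fun [set: R] (@Num.sqrt R).
  by apply: continuous_measurable_fun; exact: sqrt_continuous.
apply: (measurableT_comp msqrt); exact: measurable_dotv.
Qed.

Lemma mx_measurable_normalize p (X : T -> 'cV[R]_p) :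
  mx_measurable X -> mx_measurable (fun w => normalize (X w)).
Proof.
move=> mX; apply: mx_measurableZ => //.
by apply: measurable_inv; exact: measurable_enorm.
Qed.

Lemma mx_measurable_drop2_append p q (A : T -> 'M[R]_(p, q)) u v :
  mx_measurable A -> mx_measurable u -> mx_measurable v ->
  mx_measurable (fun w => drop2_append (A w) (u w) (v w)).
Proof.
move=> mA mu mv i j; under eq_fun do rewrite mxE.
by case: insubP => [j' _ _|_]; [exact: mA|case: (_ == q); [exact: mu|exact: mv]].
Qed.

(** Matrices with rational entries and inverse integer radii index a countable
    basis of the topology, and balls are products of intervals. *)
Lemma mx_measurable_open p q (X : T -> 'M[R]_(p, q)) (O : set 'M[R]_(p, q)) :
  mx_measurable X -> open O -> measurable (X @^-1` O).
Proof.
move=> mX oO.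
pose B (i : 'M[rat]_(p, q) * nat) : set 'M[R]_(p, q) :=
  ball (map_mx (@ratr R) i.1 : 'M[R]_(p, q)) i.2.+1%:R^-1.
have mB i : measurable (X @^-1` B i).
  rewrite [Y in measurable Y](_ : _ = \bigcap_(a in [set: 'I_p * 'I_q])
      ((fun w => X w a.1 a.2) @^-1` ball (ratr (i.1 a.1 a.2) : R) i.2.+1%:R^-1)).
    apply: fin_bigcap_measurable; first exact: finite_finset.
    move=> a _; rewrite -[Y in measurable Y]setTI; apply: mX => //.
    exact: measurable_ball.
  apply/seteqP; split=> w.
    by move=> [_ +] [a b] _ => /(_ a b); rewrite mxE.
  move=> H; split; first by rewrite invr_gt0 ltr0n.
  by move=> a b; have := H (a, b) I; rewrite mxE.
have -> : X @^-1` O = \bigcup_(i in [set: 'M[rat]_(p, q) * nat])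
    (if `[< B i `<=` O >] then X @^-1` B i else set0).
  apply/seteqP; split=> w; last first.
    by move=> [i _]; case: asboolP => // BO; exact: BO.
  move=> /= Xw; have : nbhs (X w) O by exact: open_nbhs_nbhs.
  move=> /nbhs_ballP[e /= e0 eO].
  have [k ke] : exists k, k.+1%:R^-1 < e / 2.
    have e2 : 0 < e / 2 by rewrite divr_gt0.
    by have [k] := @ltr_add_invr R 0 (e / 2) e2; rewrite add0r; exists k.
  have k0 : 0 < k.+1%:R^-1 :> R by rewrite invr_gt0 ltr0n.
  have ke2 : k.+1%:R^-1 + k.+1%:R^-1 <= e :> R.
    by move: (k.+1%:R^-1) ke => t; lra.
  have /choice[r hr] : forall a : 'I_p * 'I_q, exists r : rat,
      `|ratr r - X w a.1 a.2| < k.+1%:R^-1 :> R.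
    move=> a; have : X w a.1 a.2 - k.+1%:R^-1 < X w a.1 a.2 + k.+1%:R^-1.
      by move: (k.+1%:R^-1) k0 => t; lra.
    by move=> /rat_in_itvoo[r]; rewrite in_itv/= => h; exists r; rewrite ltr_distl.
  exists (\matrix_(a, b) r (a, b), k) => //.
  have wB : B (\matrix_(a, b) r (a, b), k) (X w).
    by split => // a b; rewrite !mxE; exact: hr.
  rewrite asboolT// => M BM; apply: eO.
  apply: (@le_ball _ _ _ (k.+1%:R^-1 + k.+1%:R^-1)); first exact: ke2.
  apply: ball_triangle BM; exact: ball_sym.
apply: countable_bigcupT_measurable; first exact: countableP.
by move=> i; case: asboolP.
Qed.

Lemma measurable_continuous p q (X : T -> 'M[R]_(p, q)) (g : 'M[R]_(p, q) -> R) :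
  mx_measurable X -> continuous g -> measurable_fun [set: T] (g \o X).
Proof.
move=> mX /continuousP cg.
apply: (measurability _ (RGenOpens.measurableE R)) => //.
move=> _ [_ [a [b ->] <-]]; rewrite setTI comp_preimage.
apply: mx_measurable_open => //; apply: cg; exact: interval_open.
Qed.

Lemma mx_measurable_continuous p q p' q' (X : T -> 'M[R]_(p, q))
  (g : 'M[R]_(p, q) -> 'M[R]_(p', q')) :
  mx_measurable X -> continuous g -> mx_measurable (g \o X).
Proof.
move=> mX cg i j; apply: (@measurable_continuous _ _ X (fun M => g M i j)) => //.
move=> M; apply: (@continuous_comp _ _ _ g (fun M => M i j)); first exact: cg.
exact: coord_continuous.
Qed.

(** On D the function Y is the composition of X with a function defined and
    1-Lipschitz on X(D) only, so the preimage by Y of an open half-line is the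
    trace on D of the preimage by X of a union of balls. *)
Lemma measurable_lipschitz_factor p q (D : set T) (X : T -> 'M[R]_(p, q))
    (Y : T -> R) : mx_measurable X ->
  (forall w w', D w -> D w' -> (Y w - Y w') ^+ 2 <= frobenius_sqr (X w - X w')) ->
  measurable_fun D Y.
Proof.
move=> mX lip mD; apply: (measurability _ (RGenOInfty.measurableE R)) => //.
move=> _ [_ [a ->] <-]; rewrite preimage_itvoy.
pose K : R := p%:R * q%:R.
have K0 : 0 <= K by rewrite mulr_ge0.
(* Balls are for the sup norm, whose square times K bounds the squared Frobenius
   norm; K + 1 keeps the inequality strict and the quotient defined. *)
pose r w := (Y w - a) / (K + 1).
pose O := \bigcup_(w in D `&` [set w | a < Y w]) ball (X w) (r w).
rewrite [Y in measurable Y](_ : _ = D `&` X @^-1` O).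
  apply: measurableI => //; apply: mx_measurable_open => //.
  by apply: bigcup_open => w _; exact: ball_open.
apply/seteqP; split=> w [Dw /=].
  move=> aY; split=> //; exists w => //; apply: ballxx.
  by rewrite divr_gt0 ?subr_gt0//; lra.
move=> [w' [Dw' /= aY'] [r0 Xball]]; split=> //.
have : (Y w' - Y w) ^+ 2 < (Y w' - a) ^+ 2.
  apply: (le_lt_trans (lip _ _ Dw' Dw)).
  apply: (@le_lt_trans _ _ (K * r w' ^+ 2)).
    apply: (@le_trans _ _ (\sum_(i < p) \sum_(j < q) r w' ^+ 2)).
      apply: ler_sum => i _; apply: ler_sum => j _.
      have := Xball i j; rewrite /ball/= => h.
      rewrite !mxE -real_normK ?num_real// ler_pXn2r ?nnegrE//; first exact: ltW.
      exact: ltW.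
    by rewrite !sumr_const !card_ord -mulr_natl -[_ *+ q]mulr_natl mulrA.
  have Y0 : 0 < Y w' - a by rewrite subr_gt0.
  have K1 : 0 < K + 1 by lra.
  rewrite /r expr_div_n mulrCA -[ltRHS]mulr1 ltr_pM2l ?exprn_gt0//.
  rewrite ltr_pdivrMr ?exprn_gt0//; nra.
rewrite -[ltLHS]real_normK ?num_real// ltr_pXn2r ?nnegrE ?subr_ge0 ?(ltW aY')//.
by move=> /ltr_normlW; lra.
Qed.

Lemma measurable_opnorm p q (A : T -> 'M[R]_(p, q)) : mx_measurable A ->
  measurable_fun [set: T] (fun w => opnorm (A w)).
Proof.
move=> mA; apply: (measurable_lipschitz_factor mA) => w w' _ _.
exact: opnorm_lipschitz.
Qed.

End MatrixMeasurability.

Lemma measurable_le_set (R : realType) d (T : measurableType d) (g h : T -> R) :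
  measurable_fun [set: T] g -> measurable_fun [set: T] h ->
  measurable [set w | g w <= h w].
Proof.
move=> mg mh.
have -> : [set w | g w <= h w] =
    [set: T] `&` (fun w => g w <= h w) @^-1` [set true].
  by rewrite setTI; apply/seteqP; split=> w.
exact: measurable_fun_ler.
Qed.

Lemma mx_measurable_comp (R : realType) d1 d2 (T1 : measurableType d1)
    (T2 : measurableType d2) p q (Z : T2 -> 'M[R]_(p, q)) (g : T1 -> T2) :
  mx_measurable Z -> measurable_fun [set: T1] g ->
  mx_measurable (fun w => Z (g w)).
Proof. by move=> mZ mg i j; exact: measurableT_comp (mZ i j) mg. Qed.

Lemma mx_measurable_g_sigma_sub (R : realType) disp (T : measurableType disp)
    (G1 G2 : set (set T)) p q (Z : T -> 'M[R]_(p, q)) :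
  G1 `<=` G2 ->
  mx_measurable (Z : g_sigma_algebraType G1 -> 'M[R]_(p, q)) ->
  mx_measurable (Z : g_sigma_algebraType G2 -> 'M[R]_(p, q)).
Proof.
move=> G12 mZ i j _ A mA.
exact: sub_sigma_algebra2 G12 _ (mZ i j measurableT A mA).
Qed.

(** * Measurability of one step of the algorithm *)

Section BacktrackingMeasurability.
Context {R : realType} {dT : measure_display} {T : measurableType dT}.

(** On the event that i is the first success, which involves finitely many tests,
    alpha equals [a i]. *)
Lemma measurable_first_success (a : nat -> R) (A : nat -> T -> bool)
    (alpha : T -> R) :
  (forall i, measurable_fun [set: T] (A i)) ->
  (forall w, exists i, [/\ alpha w = a i, A i w &
     forall j, (j < i)%N -> ~ A j w]) ->
  measurable_fun [set: T] alpha.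
Proof.
move=> mA first _ Y mY; rewrite setTI.
pose B i := A i @^-1` [set true] `&`
  \bigcap_(j in [set j | (j < i)%N]) A j @^-1` [set false].
have mpre i b : measurable (A i @^-1` [set b]).
  by rewrite -[X in measurable X]setTI; exact: mA.
have -> : alpha @^-1` Y = \bigcup_(i in [set i | Y (a i)]) B i.
  apply/seteqP; split=> w.
    move=> Yw; have [i [wi Ai Aj]] := first w.
    exists i; first by rewrite /= -wi.
    by split=> // j /= ji; apply/negbTE/negP; exact: Aj.
  move=> [i /= Yi [Ai Aj]]; have [i' [wi' Ai' Aj']] := first w.
  rewrite /= wi'; suff -> : i' = i by [].
  case: (ltngtP i' i) => // lt; last by case: (Aj' _ lt Ai).
  by have /= := Aj i' lt; rewrite Ai'.
apply: bigcup_measurable => i _; apply: measurableI => //.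
by apply: fin_bigcap_measurable => //; exact: finite_II.
Qed.

End BacktrackingMeasurability.

Section StepMeasurability.
Context {R : realType} {dT : measure_display} {T : measurableType dT}.
Variables (n m : nat) (f : 'cV[R]_n -> R) (beta c M1 M2 : R).
Hypothesis f_C2 : class_C2 f.
Hypothesis hM : 0 < M1 <= M2.
Variables (P : T -> 'M[R]_(n, m)) (x x' : T -> 'cV[R]_n)
  (H H' Hdeg : T -> 'M[R]_m) (alpha : T -> R).
Hypothesis mP : mx_measurable P.
Hypothesis mx : mx_measurable x.
Hypothesis mH : mx_measurable H.
Hypothesis mHdeg : mx_measurable Hdeg.

Let g w u := f (x w + P w *m u).
Let dir w := - (H w *m grad (g w) 0).
Let s w := alpha w *: dir w.
Let y w := grad (g w) (s w) - grad (g w) 0.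

Hypothesis step_alpha : forall w, exists i : nat,
  [/\ alpha w = beta ^+ i,
     f (x w + beta ^+ i *: (P w *m dir w))
       <= g w 0 + c * beta ^+ i * dotv (grad (g w) 0) (dir w) &
     forall j, (j < i)%N ->
       ~ f (x w + beta ^+ j *: (P w *m dir w))
           <= g w 0 + c * beta ^+ j * dotv (grad (g w) 0) (dir w)].
Hypothesis step_x : forall w, x' w = x w + alpha w *: (P w *m dir w).
Hypothesis step_H : forall w, if dotv (s w) (y w) == 0 then H' w = Hdeg w
  else eigen_clip M1 M2 (bfgs_update (H w) (s w) (y w)) (H' w).

Let df z : differentiable f z. Proof. by case: f_C2. Qed.

Lemma mx_measurable_gradient (z : T -> 'cV[R]_n) :
  mx_measurable z -> mx_measurable (fun w => grad f (z w)).
Proof.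
move=> mz; apply: (mx_measurable_continuous (g := grad f)) => // v.
by apply: differentiable_continuous; case: f_C2.
Qed.

Lemma measurable_objective (z : T -> 'cV[R]_n) :
  mx_measurable z -> measurable_fun [set: T] (fun w => f (z w)).
Proof.
move=> mz; apply: (measurable_continuous (g := f)) => // v.
exact: differentiable_continuous.
Qed.

Let mgrad (u : T -> 'cV[R]_m) :
  mx_measurable u -> mx_measurable (fun w => grad (g w) (u w)).
Proof.
move=> mu; under eq_fun do rewrite grad_affine//.
apply: mx_measurableM; first exact: mx_measurable_tr.
apply: mx_measurable_gradient; apply: mx_measurableD => //.
exact: mx_measurableM.
Qed.

Let mdir : mx_measurable dir.
Proof.
apply/mx_measurableN/mx_measurableM => //.
exact/(mgrad (u := fun=> 0))/mx_measurable_cst.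
Qed.

Let mPdir : mx_measurable (fun w => P w *m dir w).
Proof. exact: mx_measurableM. Qed.

Lemma measurable_step_size : measurable_fun [set: T] alpha.
Proof.
apply: measurable_first_success step_alpha => i.
apply: measurable_fun_ler.
  apply: measurable_objective; apply: mx_measurableD => //.
  exact/mx_measurableZ.
apply: measurable_funD.
  apply: measurable_objective; apply: mx_measurableD => //.
  exact/mx_measurableM/mx_measurable_cst.
apply: measurable_funM => //; apply: measurable_dotv => //.
exact/(mgrad (u := fun=> 0))/mx_measurable_cst.
Qed.

Lemma mx_measurable_next_iterate : mx_measurable x'.
Proof.
have -> : x' = fun w => x w + alpha w *: (P w *m dir w) by apply/funext.
exact/mx_measurableD/mx_measurableZ/mPdir/measurable_step_size.
Qed.

Let ms : mx_measurable s.
Proof. exact/mx_measurableZ/mdir/measurable_step_size. Qed.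

Let my : mx_measurable y.
Proof.
by apply: mx_measurableB; [exact: mgrad|exact/(mgrad (u := fun=> 0))/mx_measurable_cst].
Qed.

Let mbfgs : mx_measurable (fun w => bfgs_update (H w) (s w) (y w)).
Proof.
have mr : measurable_fun [set: T] (fun w => (dotv (s w) (y w))^-1).
  by apply: measurable_inv; exact: measurable_dotv.
apply: mx_measurableD; last first.
  by apply: mx_measurableZ => //; apply: mx_measurableM => //; exact: mx_measurable_tr.
have m1 (u v : T -> 'cV[R]_m) : mx_measurable u -> mx_measurable v ->
    mx_measurable (fun w => 1%:M - (dotv (s w) (y w))^-1 *: (u w *m (v w)^T)).
  move=> mu mv; apply: mx_measurableB; first exact: mx_measurable_cst.
  by apply: mx_measurableZ => //; apply: mx_measurableM => //; exact: mx_measurable_tr.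
by do 2?apply: mx_measurableM => //; exact: m1.
Qed.

(** The next matrix is given by a relation, not by a formula. Where the update is
    defined it is a Lipschitz function of the BFGS matrix, and elsewhere it is
    [Hdeg]. *)
Lemma mx_measurable_next_inverse_hessian : mx_measurable H'.
Proof.
move=> i j; set b := fun w => dotv (s w) (y w) == 0.
have mb : measurable_fun [set: T] b.
  by apply: measurable_fun_eqr => //; exact: measurable_dotv.
have -> : (fun w => H' w i j) = fun w => if b w then Hdeg w i j else H' w i j.
  by apply/funext => w; rewrite /b; have := step_H w; case: ifP => // _ ->.
apply: measurable_fun_if => //; first exact: measurable_funTS.
rewrite setTI; apply: (measurable_lipschitz_factor mbfgs) => w w' /= bw bw'.
have := step_H w; rewrite -/(b w) bw => Hw.
have := step_H w'; rewrite -/(b w') bw' => Hw'.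
case/andP: (hM) => _ M12.
apply: le_trans (eigen_clip_lipschitz M12 Hw Hw').
rewrite /frobenius_sqr (bigD1 i)//= (bigD1 j)//= !mxE -addrA lerDl.
by rewrite addr_ge0// sumr_ge0// => k _; rewrite ?sumr_ge0// ?sqr_ge0// => l _;
  rewrite sqr_ge0.
Qed.

End StepMeasurability.

(** * Independent sigma-algebras *)

Lemma bigsetI_seqP (I : eqType) (T : Type) (J : seq I) (F : I -> set T) w :
  (\big[setI/setT]_(i <- J) F i) w <-> forall i, i \in J -> F i w.
Proof.
elim: J => [|j J IH]; first by rewrite big_nil.
rewrite big_cons; split=> [[Fj /IH FJ] i|FJ].
  by rewrite inE => /orP[/eqP ->//|]; exact: FJ.
split; first by apply: FJ; rewrite mem_head.
by apply/IH => i iJ; apply: FJ; rewrite inE iJ orbT.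
Qed.

Section Independence.
Context {disp : measure_display} {T : measurableType disp} {R : realType}
        (P : probability T R).
Local Open Scope ereal_scope.

Lemma g_sigma_measurable (G : set (set T)) :
  G `<=` measurable -> <<s G >> `<=` measurable.
Proof. by apply: smallest_sub; exact: sigma_algebra_measurable. Qed.

Lemma independent_setC (A B : set T) : measurable A -> measurable B ->
  P (A `&` B) = P A * P B -> P (~` A `&` B) = P (~` A) * P B.
Proof.
move=> mA mB AB; rewrite setIC -setDE.
have -> : P (B `\` A) = P B - P (A `&` B).
  rewrite [A `&` B]setIC; apply: measureD => //.
  by rewrite (le_lt_trans (probability_le1 _ mB))// ltry.
by rewrite AB probability_setC// muleBl ?fin_num_measure// mul1e.
Qed.

Lemma independent_bigcup (F : (set T)^nat) (B : set T) :
  (forall n, measurable (F n)) -> measurable B -> trivIset setT F ->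
  (forall n, P (F n `&` B) = P (F n) * P B) ->
  P (\bigcup_k F k `&` B) = P (\bigcup_k F k) * P B.
Proof.
move=> mF mB tF FB; have PBfin : P B \is a fin_num by exact: fin_num_measure.
rewrite setI_bigcupl measure_bigcup//; last 2 first.
- by move=> n _; exact: measurableI.
- exact: trivIset_setIr.
rewrite measure_bigcup// -[P B]fineK// muleC -nneseriesZl//.
by apply: eq_eseriesr => n _; rewrite fineK// [RHS]muleC; exact: FB.
Qed.

(** The events satisfying the product rule with B form a Dynkin system. *)
Lemma independent_g_sigma_l (G : set (set T)) (B : set T) :
  setI_closed G -> G `<=` measurable -> measurable B ->
  (forall A, G A -> P (A `&` B) = P A * P B) ->
  forall A, <<s G >> A -> P (A `&` B) = P A * P B.
Proof.
move=> GI Gm mB GB.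
have sGm := g_sigma_measurable Gm.
apply: (@dynkin_induction _ (g_sigma_algebraType G) G
  (fun A : set T => P (A `&` B) = P A * P B)) => //.
- by rewrite setTI probability_setT mul1e.
- by move=> A /sGm mA; exact: independent_setC.
- by move=> F mF tF FB; apply: independent_bigcup => // n; apply: sGm; exact: mF.
Qed.

Lemma independent_g_sigma (G1 G2 : set (set T)) :
  setI_closed G1 -> setI_closed G2 -> G1 `<=` measurable -> G2 `<=` measurable ->
  (forall A B, G1 A -> G2 B -> P (A `&` B) = P A * P B) ->
  forall A B, <<s G1 >> A -> <<s G2 >> B -> P (A `&` B) = P A * P B.
Proof.
move=> G1I G2I G1m G2m G12 A B sA sB.
apply: (independent_g_sigma_l G1I G1m _ _ sA); first exact: g_sigma_measurable sB.
move=> A1 GA1; rewrite setIC muleC.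
by apply: (independent_g_sigma_l G2I G2m (G1m _ GA1) _ sB) => B1 GB1;
  rewrite setIC muleC G12.
Qed.

Context {I : eqType} (X : I -> {RV P >-> R}).

Definition family_gen (S : set I) : set (set T) :=
  [set B | exists i A, [/\ S i, measurable A & B = X i @^-1` A]].

(** Unlike [family_gen S], which generates the same sigma-algebra, this family is
    closed under intersection, as the Dynkin argument requires. *)
Definition family_cylinders (S : set I) : set (set T) :=
  [set B | exists (J : seq I) (A : I -> set R),
    [/\ uniq J, (forall i, i \in J -> S i), (forall i, measurable (A i)) &
        B = \big[setI/setT]_(i <- J) (X i @^-1` A i)]].

Lemma family_cylinders_setI S : setI_closed (family_cylinders S).
Proof.
move=> _ _ [J1 [A1 [_ S1 m1 ->]]] [J2 [A2 [_ S2 m2 ->]]].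
exists (undup (J1 ++ J2)), (fun i => (if i \in J1 then A1 i else setT) `&`
  (if i \in J2 then A2 i else setT)); split.
- exact: undup_uniq.
- by move=> i; rewrite mem_undup mem_cat => /orP[/S1|/S2].
- by move=> i; apply: measurableI; case: ifP.
- apply/seteqP; split=> w.
    move=> [/bigsetI_seqP w1 /bigsetI_seqP w2]; apply/bigsetI_seqP => i _ /=.
    by split; case: ifP => // iJ; [exact: w1|exact: w2].
  move=> /bigsetI_seqP h.
  by split; apply/bigsetI_seqP => i iJ; have := h i;
    rewrite mem_undup mem_cat iJ ?orbT /= => /(_ isT)[].
Qed.

Lemma family_cylinders_measurable S : family_cylinders S `<=` measurable.
Proof.
move=> _ [J [A [_ _ mA ->]]]; apply: bigsetI_measurable => i _.
exact: measurable_funPTI.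
Qed.

Lemma family_gen_cylinders S : family_gen S `<=` family_cylinders S.
Proof.
move=> _ [i [A [Si mA ->]]]; exists [:: i], (fun=> A); split=> //.
  by move=> j; rewrite inE => /eqP ->.
by rewrite big_seq1.
Qed.

Lemma family_gen_measurable S : family_gen S `<=` measurable.
Proof. exact/(subset_trans (@family_gen_cylinders S))/family_cylinders_measurable. Qed.

(** On cylinders over disjoint index sets this is the product rule for the union of
    the two finite families of indices. *)
Lemma independent_families S1 S2 : mutually_independent X ->
  (forall i, S1 i -> S2 i -> False) ->
  forall A B, <<s family_gen S1 >> A -> <<s family_gen S2 >> B ->
    P (A `&` B) = P A * P B.
Proof.
move=> indep S12 A B sA sB.
apply: (@independent_g_sigma (family_cylinders S1) (family_cylinders S2)).
- exact: family_cylinders_setI.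
- exact: family_cylinders_setI.
- exact: family_cylinders_measurable.
- exact: family_cylinders_measurable.
- move=> _ _ [J1 [A1 [u1 s1 m1 ->]]] [J2 [A2 [u2 s2 m2 ->]]].
  pose A' i := if i \in J1 then A1 i else A2 i.
  have mA' i : measurable (A' i) by rewrite /A'; case: ifP.
  have J12 i : i \in J2 -> (i \in J1) = false.
    by move=> /s2 S2i; apply/negP => /s1 /S12; apply.
  have E1 : \big[setI/setT]_(i <- J1) (X i @^-1` A1 i) =
      \big[setI/setT]_(i <- J1) (X i @^-1` A' i).
    by apply: eq_big_seq => i iJ; rewrite /A' iJ.
  have E2 : \big[setI/setT]_(i <- J2) (X i @^-1` A2 i) =
      \big[setI/setT]_(i <- J2) (X i @^-1` A' i).
    by apply: eq_big_seq => i iJ; rewrite /A' J12.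
  rewrite E1 E2 -big_cat/= !indep// ?big_cat//=.
  rewrite cat_uniq u1 u2 andbT/=; apply/hasPn => i iJ2.
  by rewrite J12.
- exact: sub_sigma_algebra2 (@family_gen_cylinders S1) _ sA.
- exact: sub_sigma_algebra2 (@family_gen_cylinders S2) _ sB.
Qed.

End Independence.

Section IndependentPair.
Context {disp d1 d2 : measure_display} {T : measurableType disp}
  {T1 : measurableType d1} {T2 : measurableType d2} {R : realType}
  (P : probability T R).
Local Open Scope ereal_scope.
Variables (X : {RV P >-> T1}) (Y : {RV P >-> T2}).
Hypothesis XY_indep : forall A B, measurable A -> measurable B ->
  P (X @^-1` A `&` Y @^-1` B) = P (X @^-1` A) * P (Y @^-1` B).

Let Z : T -> T1 * T2 := fun w => (X w, Y w).
Let mZ : measurable_fun setT Z.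
Proof. exact: measurable_fun_pair. Qed.
HB.instance Definition _ := isMeasurableFun.Build _ _ _ _ Z mZ.

(** The two measures agree on rectangles, and a product measure is determined by
    its values on them. *)
Lemma joint_distribution_indep (A : set (T1 * T2)) : measurable A ->
  distribution P Z A = (distribution P X \x distribution P Y) A.
Proof.
by move=> mA; apply/esym/product_measure_unique.
Qed.

Lemma integral_indep_pair (F : T1 * T2 -> \bar R) :
  measurable_fun setT F -> (forall z, 0 <= F z) ->
  \int[P]_w F (X w, Y w) =
  \int[distribution P X]_x \int[distribution P Y]_y F (x, y).
Proof.
move=> mF F0.
rewrite -(fubini_tonelli1 F)//.
rewrite -(@ge0_integral_distribution _ _ _ _ _ P Z F)//.
by apply: eq_measure_integral => A mA _; exact: joint_distribution_indep.
Qed.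

(** Replaces conditioning on X: by Tonelli, Y may be integrated first with X = x
    fixed, and then sees only the section of E at x. *)
Lemma integral_indep_section_ge (E : set (T1 * T2)) (h : T1 -> R) (p : R) :
  measurable E -> measurable_fun setT h -> (forall x, (0 <= h x)%R) -> (0 <= p)%R ->
  (forall x, p%:E <= P (Y @^-1` [set y | E (x, y)])) ->
  p%:E * \int[P]_w (h (X w))%:E <=
  \int[P]_w (h (X w) * \1_E (X w, Y w))%:E.
Proof.
move=> mE mh h0 p0 pE.
have mF : measurable_fun setT (fun z : T1 * T2 => (h z.1 * \1_E z)%:E).
  apply/measurable_EFinP; apply: measurable_funM; last exact: measurable_indic.
  exact: measurableT_comp.
rewrite (@integral_indep_pair (fun z => (h z.1 * \1_E z)%:E))//; last first.
  by move=> z; rewrite lee_fin mulr_ge0.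
have mhE : measurable_fun setT (fun x => (h x)%:E) by exact/measurable_EFinP.
rewrite -(@ge0_integral_distribution _ _ _ _ _ P X (fun x => (h x)%:E))//.
have hE0 x : 0 <= (h x)%:E by rewrite lee_fin.
rewrite -ge0_integralZl//.
apply: ge0_le_integral => //.
- by move=> x _; rewrite mule_ge0// lee_fin.
- exact: measurable_funeM.
- apply: (measurable_fun_fubini_tonelli_F (m2 := distribution P Y)
    (fun z : T1 * T2 => (h z.1 * \1_E z)%:E)) => // z.
  by rewrite lee_fin mulr_ge0.
move=> x _ /=.
under eq_integral do rewrite EFinM.
have mEx : measurable [set y | E (x, y)].
  by have := measurable_xsection x mE; rewrite xsectionE.
have E1 : (fun y => (\1_E (x, y))%:E) =
    (fun y => (\1_[set y | E (x, y)] y)%:E) :> (T2 -> \bar R).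
  by apply/funext => y; rewrite !indicE; congr (_%:R%:E); apply/idP/idP; rewrite !inE.
have mI : measurable_fun setT (fun y => (\1_E (x, y))%:E : \bar R).
  by rewrite E1; apply/measurable_EFinP; exact: measurable_indic.
have I0 y : 0 <= (\1_E (x, y))%:E :> \bar R by rewrite lee_fin.
rewrite ge0_integralZl//.
rewrite E1 integral_indic// setIT muleC lee_wpmul2l ?lee_fin//.
exact: pE.
Qed.

End IndependentPair.

Section SubSigmaAlgebras.
Context {disp : measure_display} {T : measurableType disp} {R : realType}
        (P : probability T R).
Variables (G1 G2 : set (set T)).
Hypothesis G1m : G1 `<=` measurable.
Hypothesis G2m : G2 `<=` measurable.
Hypothesis G12_indep : forall A B, <<s G1 >> A -> <<s G2 >> B ->
  (P (A `&` B) = P A * P B)%E.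

Let T1 := g_sigma_algebraType G1.
Let T2 := g_sigma_algebraType G2.

Lemma measurable_id_g_sigma (G : set (set T)) : G `<=` measurable ->
  measurable_fun [set: T] (fun w : T => w : g_sigma_algebraType G).
Proof. by move=> Gm _ A mA; rewrite setTI; exact: g_sigma_measurable mA. Qed.

(** The preceding lemma for the identity of T seen as a random variable with values
    in T equipped with each of two independent sub-sigma-algebras. *)
Lemma integral_g_sigma_section_ge (E : set (T1 * T2)) (h : T1 -> R) (p : R) :
  measurable E -> measurable_fun [set: T1] h -> (forall w, 0 <= h w) -> 0 <= p ->
  (forall w, (p%:E <= P [set w' : T | E (w, w')])%E) ->
  (p%:E * \int[P]_w (h w)%:E <=
   \int[P]_w (h w * \1_E (w : T1, w : T2))%:E)%E.
Proof.
move=> mE mh h0 p0 pE.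
pose X : {RV P >-> T1} := HB.pack (fun w : T => w : T1)
  (isMeasurableFun.Build _ _ _ _ (fun w : T => w : T1) (measurable_id_g_sigma G1m)).
pose Y : {RV P >-> T2} := HB.pack (fun w : T => w : T2)
  (isMeasurableFun.Build _ _ _ _ (fun w : T => w : T2) (measurable_id_g_sigma G2m)).
exact: (@integral_indep_section_ge _ _ _ T T1 T2 R P X Y G12_indep E h p).
Qed.

End SubSigmaAlgebras.

(** * Bounded variables and quadratic recursions *)

Section BoundedIntegrals.
Context {disp : measure_display} {T : measurableType disp} {R : realType}
        (P : probability T R).

Lemma bounded_integrable (g : T -> R) (b : R) :
  measurable_fun [set: T] g -> (forall w, 0 <= g w <= b) ->
  P.-integrable [set: T] (EFin \o g).
Proof.
move=> mg gb; apply: measurable_bounded_integrable => //.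
  by rewrite (le_lt_trans (probability_le1 _ _)) ?ltry.
exists b; split; first exact: num_real.
move=> x bx w _; case/andP: (gb w) => g0 gb'.
by rewrite /= ger0_norm// (le_trans gb')// ltW.
Qed.

Lemma Rintegral_prob_cst (r : R) : \int[P]_w r = r.
Proof.
transitivity (r * fine (P [set: T])); first exact: Rintegral_cst.
by rewrite probability_setT/= mulr1.
Qed.

(** Integrate 2 a g <= g^2 + a^2, where a is the mean of g. *)
Lemma Rintegral_sqr_ge (g : T -> R) (b : R) :
  measurable_fun [set: T] g -> (forall w, 0 <= g w <= b) ->
  (\int[P]_w g w) ^+ 2 <= \int[P]_w (g w ^+ 2).
Proof.
move=> mg gb; set a := \int[P]_w g w.
have ig := bounded_integrable mg gb.
have ig2 : P.-integrable [set: T] (EFin \o (fun w => g w ^+ 2)).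
  apply: (@bounded_integrable _ (b ^+ 2)); first exact: measurable_funX.
  move=> w; rewrite sqr_ge0/=; case/andP: (gb w) => g0 gb'.
  by rewrite ler_pXn2r ?nnegrE ?(le_trans g0 gb').
have ia : P.-integrable [set: T] (EFin \o cst (a ^+ 2)).
  by apply: (@bounded_integrable _ (a ^+ 2)) => // w /=; rewrite sqr_ge0 lexx.
have : \int[P]_w (2 * a * g w) <= \int[P]_w (g w ^+ 2 + a ^+ 2).
  apply: le_Rintegral => //.
  - rewrite (_ : _ \o _ = (fun w => (2 * a)%:E * (g w)%:E)%E)//.
    exact: (integrableZl measurableT _ ig).
  - rewrite (_ : _ \o _ = (fun w => (g w ^+ 2)%:E + (a ^+ 2)%:E)%E)//.
    exact: (integrableD measurableT ig2 ia).
  - by move=> w _; have := sqr_ge0 (g w - a); rewrite sqrrB -mulr_natl; lra.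
rewrite RintegralZl// RintegralD// Rintegral_prob_cst -/a; lra.
Qed.

End BoundedIntegrals.

(** Taking inverses turns the quadratic recursion into
    1 / e_(k+1) >= 1 / e_k + q / r, where 1 / e_0 >= 2 / (L r). The proof clears
    the denominators, because e_k and r may vanish. *)
Lemma quadratic_decrease_rate (R : realFieldType) (e : nat -> R) (L q r : R) :
  0 <= L -> 0 <= q -> 0 <= r -> (forall k, 0 <= e k) -> (forall k, e k.+1 <= e k) ->
  e 0%N <= L / 2 * r -> (forall k, r * e k.+1 <= r * e k - q * e k ^+ 2) ->
  forall k, e k * (2 + L * q * k%:R) <= L * r.
Proof.
move=> L0 q0 r0 e0 mono init rec; elim=> [|k IH]; first by lra.
have [ek0|ek_gt0] := lerP (e k) 0.
  have -> : e k.+1 = 0 by apply/eqP; rewrite eq_le e0 (le_trans (mono k)).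
  by rewrite mul0r mulr_ge0.
have h1 : q * (e k * e k.+1) <= r * (e k - e k.+1).
  apply: (@le_trans _ _ (q * e k ^+ 2)); last first.
    by rewrite mulrBr lerBrDr addrC -lerBrDr; exact: rec.
  by rewrite expr2 ler_wpM2l// ler_wpM2l// ltW.
have h2 := ler_wpM2l (e0 k.+1) IH.
have h3 := ler_wpM2l L0 h1.
rewrite -(ler_pM2l ek_gt0) -(natr1 k).
move: (k%:R : R) (e k) (e k.+1) h2 h3 => kk a b h2 h3; lra.
Qed.

(** * Probability of a good sketch *)

Section GoodSketch.
Context {R : realType} {dT : measure_display} {T : measurableType dT} (n d : nat).

Lemma measurable_good_sketch (a b : R) (Q : T -> 'M[R]_(n, d)) (v : T -> 'cV[R]_n) :
  mx_measurable Q -> mx_measurable v ->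
  measurable [set w | good_sketch a b (Q w) (v w)].
Proof.
move=> mQ mv; have mQt := mx_measurable_tr mQ.
apply: measurableI; apply: measurable_le_set.
- by apply: measurable_funM => //; exact: measurable_dotv.
- by apply: measurable_dotv; exact: mx_measurableM.
- by apply: measurable_dotv; apply: mx_measurableM => //; exact: mx_measurableM.
- by apply: measurable_funM => //; exact: measurable_dotv.
Qed.

End GoodSketch.

Section SketchProbability.
Context {disp : measure_display} {T : measurableType disp} {R : realType}
        (P : probability T R) (n d : nat).
Variables (C0 C : R).
Hypothesis d_gt0 : (0 < d)%N.
Hypothesis n_gt0 : (0 < n)%N.
Hypothesis C_gt0 : 0 < C.
Hypothesis C0P : sketch_constant P n d C0.
Hypothesis CP : gram_constant P n d C.
Variable G : 'I_n -> 'I_d -> {RV P >-> R}.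
Hypothesis gaussG : gaussian_mx G.

Lemma mx_measurable_rand : mx_measurable (rand_mx G).
Proof.
by move=> i j; under eq_fun do rewrite mxE; exact: measurable_funPT.
Qed.

(** Union bound for the complements of the two events given by the constants. *)
Lemma good_sketch_prob eps v : 0 < eps < 1 ->
  ((success_prob d C0 eps)%:E <=
   P [set w | good_sketch (d%:R * (1 - eps)) (C * n%:R) (rand_mx G w) v])%E.
Proof.
move=> eps01.
have d0 : 0 < d%:R :> R by rewrite ltr0n.
have n0 : 0 < n%:R :> R by rewrite ltr0n.
have Cn0 : 0 <= C * n%:R by rewrite mulr_ge0 ?(ltW C_gt0).
have mQ := mx_measurable_rand.
have mQt := mx_measurable_tr mQ.
have mcst m (u : 'cV[R]_m) := mx_measurable_cst (T := T) u.
have := C0P gaussG v eps01; set A := [set w | _] => PA.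
have := CP gaussG; set B := [set w | _] => PB.
have mA : measurable A.
  rewrite (_ : A = [set w | (1 - eps) * enorm v ^+ 2 <=
        enorm ((Num.sqrt d%:R)^-1 *: ((rand_mx G w)^T *m v)) ^+ 2] `&`
      [set w | enorm ((Num.sqrt d%:R)^-1 *: ((rand_mx G w)^T *m v)) ^+ 2 <=
        (1 + eps) * enorm v ^+ 2]); last first.
    by apply/seteqP; split=> w /andP.
  by apply: measurableI; apply: measurable_le_set => //; apply: measurable_funX;
    apply: measurable_enorm; apply: mx_measurableZ => //; exact: mx_measurableM.
have mB : measurable B.
  apply: measurable_le_set => //; apply: measurable_funM => //; apply: measurable_opnorm.
  exact: mx_measurableM.
have AB_good : A `&` B `<=`
    [set w | good_sketch (d%:R * (1 - eps)) (C * n%:R) (rand_mx G w) v].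
  move=> w [/= /andP[Aw _] Bw]; split.
    move: Aw; rewrite enormZ exprMn !enorm_sqr ger0_norm ?invr_ge0 ?sqrtr_ge0//.
    by rewrite exprVn sqr_sqrtr ?(ltW d0)// ler_pdivlMl// mulrA.
  have op : opnorm (rand_mx G w *m (rand_mx G w)^T) <= C * n%:R.
    by move: Bw; rewrite /B /= ler_pdivrMl// mulrC -mulrA divfK// gt_eqF.
  rewrite -!enorm_sqr -exprMn ler_pXn2r ?nnegrE ?(mulr_ge0 Cn0) ?enorm_ge0//.
  apply: (le_trans (enorm_mulmx_opnorm _ _)).
  by rewrite ler_wpM2r ?enorm_ge0.
apply: (@le_trans _ _ (P (A `&` B))); last first.
  apply: le_measure; rewrite ?inE//; first exact: measurableI.
  exact: measurable_good_sketch.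
have Afin : P A \is a fin_num by exact: fin_num_measure.
have Bfin : P B \is a fin_num by exact: fin_num_measure.
have ABfin : P (A `&` B) \is a fin_num by apply: fin_num_measure; exact: measurableI.
have : (P (~` (A `&` B)) <= P (~` A) + P (~` B))%E.
  rewrite setCI; apply: measureU2; exact: measurableC.
rewrite !probability_setC//; last exact: measurableI.
move: PA PB; rewrite -(fineK Afin) -(fineK Bfin) -(fineK ABfin).
rewrite -!EFinB -EFinD !lee_fin /success_prob; lra.
Qed.

End SketchProbability.

(** * Convergence in expectation *)

Section PastAndPresent.
Context {disp : measure_display} {T : measurableType disp} {R : realType}
        (P : probability T R) (n d : nat).
Variable G : nat -> 'I_n -> 'I_d -> {RV P >-> R}.

Let entry (t : nat * 'I_n * 'I_d) : {RV P >-> R} := G t.1.1 t.1.2 t.2.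

(** The index k is excluded: the k-th iterate depends on the matrices drawn before
    step k only, and is therefore independent of the one drawn at step k. *)
Definition past (k : nat) : set (set T) :=
  family_gen entry [set t | (t.1.1 < k)%N].

Definition present (k : nat) : set (set T) :=
  family_gen entry [set t | t.1.1 = k].

Lemma family_gen_sub (S1 S2 : set (nat * 'I_n * 'I_d)) : S1 `<=` S2 ->
  family_gen entry S1 `<=` family_gen entry S2.
Proof. by move=> S12 _ [t [A [St mA ->]]]; exists t, A; split=> //; exact: S12. Qed.

Lemma past_sub k : past k `<=` past k.+1.
Proof. by apply: family_gen_sub => t /=; exact: leqW. Qed.

Lemma present_past k : present k `<=` past k.+1.
Proof. by apply: family_gen_sub => t /= ->. Qed.

Lemma historyE k : history G k = <<s past k.+1 >>.
Proof.
rewrite /history; congr (<<s _ >>); apply/seteqP; split=> B.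
  by move=> [j [i [l [A [jk mA ->]]]]]; exists (j, i, l), A.
by move=> [[[j i] l] [A [jk mA ->]]]; exists j, i, l, A.
Qed.

Lemma mx_measurable_present k : mx_measurable
  (rand_mx (G k) : g_sigma_algebraType (present k) -> 'M[R]_(n, d)).
Proof.
move=> i j; under eq_fun do rewrite mxE.
move=> _ A mA; rewrite setTI; apply: sub_gen_smallest.
by exists (k, i, j), A.
Qed.

Lemma past_present_independent k : gaussian_mx_seq G ->
  forall A B, <<s past k >> A -> <<s present k >> B -> (P (A `&` B) = P A * P B)%E.
Proof.
move=> [indep _]; apply: (independent_families indep) => t /= tk tk'.
by rewrite tk' ltnn in tk.
Qed.

Lemma gaussian_mx_seq_nth k : gaussian_mx_seq G -> gaussian_mx (G k).
Proof.
move=> [indep distr]; split=> [J A uJ mA|t A mA]; last exact: (distr (k, t.1, t.2)).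
pose inc (t : 'I_n * 'I_d) := (k, t.1, t.2).
have inc_inj : injective inc by move=> [i j] [i' j'] [-> ->].
have := indep (map inc J) (fun t => A (t.1.2, t.2)).
rewrite map_inj_uniq// => /(_ uJ (fun t => mA _)); rewrite !big_map.
under eq_bigr do rewrite /= -surjective_pairing.
by under [in RHS]eq_bigr do rewrite /= -surjective_pairing.
Qed.

End PastAndPresent.

Section Convergence.
Context (R : realType) (disp : measure_display) (T : measurableType disp)
  (P : probability T R) (n d m : nat).
Hypothesis hd : (0 < d < n)%N.
Hypothesis m_gt0 : (0 < m)%N.
Variable f : 'cV[R]_n -> R.
Hypothesis f_C2 : class_C2 f.
Variables beta c M1 M2 : R.
Hypothesis hbeta : 0 < beta < 1.
Hypothesis hc : 0 < c < 1.
Hypothesis hM : 0 < M1 <= M2.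
Variables C0 C : R.
Hypothesis hC : 0 < C.
Hypothesis C0P : sketch_constant P n d C0.
Hypothesis CP : gram_constant P n d C.
Variable L : R.
Hypothesis hL : 0 < L.
Hypothesis f_smooth : forall u v, enorm (grad f u - grad f v) <= L * enorm (u - v).
Hypothesis f_convex : convex_function [set: 'cV[R]_n] f.
Variables (x0 : 'cV[R]_n) (R0 : R).
Hypothesis hR0 : level_radius f x0 = R0%:E.
Variable H0 : 'M[R]_m.
Hypothesis hH0 : sym_between M1 M2 H0.
Variable Pinit : 'M[R]_(n, m).
Hypothesis hPinit : forall j, enorm (col j Pinit) = 1.
Variable G : nat -> 'I_n -> 'I_d -> {RV P >-> R}.
Hypothesis hG : gaussian_mx_seq G.
Variable Hdeg : nat -> T -> 'M[R]_m.
Hypothesis Hdeg_history : forall k, history_determined G k (Hdeg k).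
Hypothesis Hdeg_bounds : forall k w, sym_between M1 M2 (Hdeg k w).
Variables (x : nat -> T -> 'cV[R]_n) (H : nat -> T -> 'M[R]_m)
  (alpha : nat -> T -> R).
Hypothesis x_run : forall w, subspace_qn_path f beta c M1 M2 x0 H0 Pinit
  (fun k => rand_mx (G k) w) (Hdeg ^~ w) (x ^~ w) (H ^~ w) (alpha ^~ w).

Let df z : differentiable f z. Proof. by case: f_C2. Qed.

Local Notation pastT k := (g_sigma_algebraType (past G k)).
Local Notation presentT k := (g_sigma_algebraType (present G k)).

(** The matrix whose first two columns are dropped at step k. *)
Let previous_mx (k : nat) (w : T) : 'M[R]_(n, m) :=
  if k is k'.+1 then subspace_mx f Pinit (fun j => rand_mx (G j) w) (x ^~ w) k'
  else Pinit.

(** The induction carries the previous subspace matrix along with the iterate and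
    the approximation of the inverse Hessian: these three determine step k, given
    the k-th sketch and [Hdeg]. *)
Lemma iterates_past_measurable k :
  [/\ mx_measurable (x k : pastT k -> 'cV[R]_n),
      mx_measurable (H k : pastT k -> 'M[R]_m) &
      mx_measurable (previous_mx k : pastT k -> 'M[R]_(n, m))].
Proof.
elim: k => [|k [mx mH mP]].
  split; last exact: mx_measurable_cst.
    have -> : x 0%N = fun=> x0 by apply/funext => w; exact: path_x0 (x_run w).
    exact: mx_measurable_cst.
  have -> : H 0%N = fun=> H0 by apply/funext => w; exact: path_H0 (x_run w).
  exact: mx_measurable_cst.
have lift p q (Z : T -> 'M[R]_(p, q)) :
    mx_measurable (Z : pastT k -> 'M[R]_(p, q)) ->
    mx_measurable (Z : pastT k.+1 -> 'M[R]_(p, q)).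
  by apply: mx_measurable_g_sigma_sub; exact: past_sub.
have mx' := lift _ _ _ mx; have mH' := lift _ _ _ mH; have mP' := lift _ _ _ mP.
have mQ : mx_measurable (rand_mx (G k) : pastT k.+1 -> 'M[R]_(n, d)).
  apply: (mx_measurable_g_sigma_sub (G1 := present G k)).
    exact: present_past.
  exact: mx_measurable_present.
have mHdeg : mx_measurable (Hdeg k : pastT k.+1 -> 'M[R]_m).
  move=> i j _ A mA; rewrite setTI.
  by have := @Hdeg_history k i j A mA; rewrite historyE.
have mnew : mx_measurable (previous_mx k.+1 : pastT k.+1 -> 'M[R]_(n, m)).
  have -> : previous_mx k.+1 = (fun w => drop2_append (previous_mx k w)
      (normalize (x k w)) (normalize (sketched_grad f (rand_mx (G k) w) (x k w)))).
    by apply/funext => w; rewrite /previous_mx; case: (k).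
  apply: mx_measurable_drop2_append => //; first exact: mx_measurable_normalize.
  apply: mx_measurable_normalize; apply: mx_measurableM.
    by apply: mx_measurableM => //; exact: mx_measurable_tr.
  exact: (mx_measurable_gradient f_C2).
split=> //.
  refine (@mx_measurable_next_iterate R _ (pastT k.+1) n m f beta c f_C2
    (previous_mx k.+1) (x k) (x k.+1) (H k) (alpha k) mnew mx' mH' _ _) => w.
    by case: (path_step (x_run w) k).
  by case: (path_step (x_run w) k).
refine (@mx_measurable_next_inverse_hessian R _ (pastT k.+1) n m f beta c M1 M2 f_C2 hM
  (previous_mx k.+1) (x k) (H k) (H k.+1) (Hdeg k) (alpha k) mnew mx' mH' mHdeg
  _ _) => w.
  by case: (path_step (x_run w) k).
by case: (path_step (x_run w) k).
Qed.

Local Notation fstar := (optimal_value f).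
Let gap k w := f (x k w) - fstar.

Let past_measurable k : past G k `<=` measurable.
Proof. exact: family_gen_measurable. Qed.

Let present_measurable k : present G k `<=` measurable.
Proof. exact: family_gen_measurable. Qed.

Let gap_past_measurable k : measurable_fun [set: pastT k] (gap k).
Proof.
have [mx _ _] := iterates_past_measurable k.
by apply: measurable_funB => //; exact: (measurable_objective f_C2).
Qed.

Let gap_measurable k : measurable_fun [set: T] (gap k).
Proof.
exact: measurableT_comp (gap_past_measurable (k := k))
  (measurable_id_g_sigma (past_measurable (k := k))).
Qed.

Let level k w : f (x k w) <= f x0.
Proof.
exact: (path_le_init df hbeta hc hM hL m_gt0 f_smooth hH0 hPinit
  (Hdeg_bounds ^~ w) (x_run w)).
Qed.

Let gap_bounds k w : 0 <= gap k w <= f x0 - fstar.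
Proof. by rewrite (gap_ge0 hR0) lerD2r level. Qed.

Let mean_gap k := \int[P]_w gap k w.

Let mean_gap_ge0 k : 0 <= mean_gap k.
Proof. by apply: Rintegral_ge0 => w _; case/andP: (gap_bounds k w). Qed.

Let gap_integrable k := bounded_integrable P (@gap_measurable k) (gap_bounds k).

Let mean_gap_nonincreasing k : mean_gap k.+1 <= mean_gap k.
Proof.
apply: le_Rintegral => // w _; rewrite lerD2r.
exact: (path_nonincreasing df hbeta hc hM hL m_gt0 f_smooth hH0 hPinit
  (Hdeg_bounds ^~ w) (x_run w)).
Qed.

Let mean_gap_init : mean_gap 0 <= L / 2 * R0 ^+ 2.
Proof.
apply: le_trans (gap_init_le df hL f_smooth hR0).
have -> : f x0 - fstar = \int[P]_w (f x0 - fstar) by rewrite Rintegral_prob_cst.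
apply: le_Rintegral => //; last by move=> w _; case/andP: (gap_bounds 0 w).
apply: (@bounded_integrable _ _ _ _ _ (f x0 - fstar)) => //.
by move=> w; rewrite (gap_ge0 hR0) lexx.
Qed.

Section Rate.
Variable eps : R.
Hypothesis heps : 0 < eps < 1.
Let p := success_prob d C0 eps.
Let a : R := d%:R * (1 - eps).
Let b : R := C * n%:R.
Let lam : R := c * step_lower_bound m beta c M2 L * M1 * (a / b) ^+ 2.

Let a_gt0 : 0 < a.
Proof.
case/andP: hd => d0 _; case/andP: heps => _ e1.
by rewrite mulr_gt0 ?subr_gt0// ltr0n.
Qed.

Let b_gt0 : 0 < b.
Proof.
case/andP: hd => d0 dn.
by rewrite mulr_gt0// ltr0n (leq_ltn_trans _ dn).
Qed.

Let lam_ge0 : 0 <= lam.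
Proof.
have := step_lower_bound_gt0 (m := m) hbeta hc hM hL m_gt0.
case/andP: hc => c0 _; case/andP: hM => M0 _ abar0.
by rewrite mulr_ge0 ?sqr_ge0// !mulr_ge0 ?(ltW c0) ?(ltW abar0) ?(ltW M0).
Qed.

Let good k : set (pastT k * presentT k) :=
  [set z | good_sketch a b (rand_mx (G k) z.2) (grad f (x k z.1))].

Arguments good : clear implicits.

Let good_measurable k : measurable (good k).
Proof.
have [mx _ _] := iterates_past_measurable k.
apply: measurable_good_sketch.
  exact (@mx_measurable_comp _ _ _ (pastT k * presentT k)%type (presentT k)
    _ _ (rand_mx (G k)) snd (@mx_measurable_present _ _ _ _ _ _ G k) measurable_snd).
exact (@mx_measurable_comp _ _ _ (pastT k * presentT k)%type (pastT k)
  _ _ _ fst (mx_measurable_gradient f_C2 mx) measurable_fst).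
Qed.

Let good_path_measurable k :
  measurable [set w : T | good k (w, w)].
Proof.
have [mx _ _] := iterates_past_measurable k.
apply: measurable_good_sketch; first exact: mx_measurable_rand.
exact (@mx_measurable_comp _ _ _ T (pastT k) _ _ _ id
  (mx_measurable_gradient f_C2 mx)
  (measurable_id_g_sigma (past_measurable (k := k)))).
Qed.

(** When the sketch is good, f decreases by lam times the squared norm of the
    gradient, which is at least (gap / R0)^2; otherwise f does not increase.
    Multiplying by R0^2 covers the case R0 = 0. *)
Let path_recursion k w :
  R0 ^+ 2 * gap k.+1 w + lam * (gap k w ^+ 2 * \1_(good k) (w, w))
    <= R0 ^+ 2 * gap k w.
Proof.
have r0 : 0 <= R0 ^+ 2 by rewrite sqr_ge0.
rewrite indicE; case: (boolP (_ \in _)) => [|_]; last first.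
  rewrite !mulr0 addr0 ler_wpM2l// lerD2r.
  exact: (path_nonincreasing df hbeta hc hM hL m_gt0 f_smooth hH0 hPinit
    (Hdeg_bounds ^~ w) (x_run w)).
rewrite inE mulr1 => gd.
have := path_good_decrease df hbeta hc hM hL m_gt0 f_smooth hH0 hPinit
  (Hdeg_bounds ^~ w) (x_run w) a_gt0 b_gt0 gd.
have := gap_sqr_le_grad df hL f_smooth f_convex hR0 (level k w).
move=> /(ler_wpM2l lam_ge0) h1; rewrite mulrA -/lam => h2.
have : R0 ^+ 2 * gap k.+1 w <= R0 ^+ 2 * (gap k w -
    lam * dotv (grad f (x k w)) (grad f (x k w))).
  by rewrite ler_wpM2l// /gap; lra.
move: h1; rewrite -/(gap k w).
move: (dotv _ _) (gap k w) (gap k.+1 w) (R0 ^+ 2) => t u v r; lra.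
Qed.

(** Integrate [path_recursion]: by independence the indicator of the good event
    costs at most a factor p, and the mean of the square dominates the square of the
    mean. *)
Let mean_recursion k : 0 <= p ->
  R0 ^+ 2 * mean_gap k.+1 <= R0 ^+ 2 * mean_gap k - lam * p * mean_gap k ^+ 2.
Proof.
move=> p0.
have r0 : 0 <= R0 ^+ 2 by rewrite sqr_ge0.
pose B := (f x0 - fstar) ^+ 2.
have sqr_bounds w : 0 <= gap k w ^+ 2 <= B.
  case/andP: (gap_bounds k w) => g0 gB; rewrite sqr_ge0/=.
  by rewrite ler_pXn2r ?nnegrE// (le_trans g0).
have i2 : P.-integrable [set: T] (EFin \o (fun w => gap k w ^+ 2)).
  by apply: (bounded_integrable P _ sqr_bounds); exact: measurable_funX.
pose g3 w := gap k w ^+ 2 * \1_(good k) (w, w).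
have mg3 : measurable_fun [set: T] g3.
  apply: measurable_funM; first exact: measurable_funX.
  have -> : (fun w => \1_(good k) (w, w)) = \1_[set w : T | good k (w, w)] :> (T -> R).
    by apply/funext => w; rewrite !indicE; congr (_%:R); apply/idP/idP; rewrite !inE.
  by apply: measurable_indic; exact: good_path_measurable.
have g3_bounds w : 0 <= g3 w <= B.
  rewrite /g3 indicE; case/andP: (sqr_bounds w) => h0 hB.
  by case: (_ \in _); rewrite ?mulr1 ?mulr0 ?h0// lexx (le_trans h0).
have i3 := bounded_integrable P mg3 g3_bounds.
have ind : p * \int[P]_w (gap k w ^+ 2) <= \int[P]_w g3 w.
  have pE (w : T) : (p%:E <= P [set w' : T | good k (w, w')])%E.
    case/andP: (hd) => d0 dn.
    exact (good_sketch_prob d0 (leq_ltn_trans (leq0n d) dn) hC C0P CP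
      (gaussian_mx_seq_nth k hG) (grad f (x k w)) heps).
  have mh : measurable_fun [set: pastT k] (fun w => gap k w ^+ 2).
    exact: measurable_funX.
  have := integral_g_sigma_section_ge (past_measurable (k := k))
    (present_measurable (k := k)) (past_present_independent hG)
    (good_measurable (k := k)) mh (fun w => sqr_ge0 _) p0 pE.
  rewrite -lee_fin EFinM /Rintegral !fineK//; exact: integrable_fin_num.
have jensen := Rintegral_sqr_ge P (@gap_measurable k) (gap_bounds k).
have : \int[P]_w (R0 ^+ 2 * gap k.+1 w + lam * g3 w) <= \int[P]_w (R0 ^+ 2 * gap k w).
  apply: le_Rintegral => [//|||w _]; last exact: path_recursion.
    exact: (integrableD measurableT (integrableZl measurableT _ (gap_integrable k.+1))
      (integrableZl measurableT _ i3)).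
  exact: (integrableZl measurableT _ (gap_integrable k)).
rewrite RintegralD//; last 2 first.
- exact: (integrableZl measurableT _ (gap_integrable k.+1)).
- exact: (integrableZl measurableT _ i3).
rewrite !RintegralZl// -/(mean_gap k) -/(mean_gap k.+1).
have : lam * (p * mean_gap k ^+ 2) <= lam * \int[P]_w g3 w.
  by rewrite ler_wpM2l// (le_trans _ ind)// ler_wpM2l.
lra.
Qed.

(** If p is negative, the bound is weaker than the one at k = 0, which holds for
    all k by monotonicity. *)
Lemma mean_gap_rate k :
  mean_gap k * (2 + L * (lam * p) * k%:R) <= L * R0 ^+ 2.
Proof.
have [p0|p0] := lerP 0 p.
  exact: (quadratic_decrease_rate (ltW hL) (mulr_ge0 lam_ge0 p0) (sqr_ge0 R0)
    mean_gap_ge0 mean_gap_nonincreasing mean_gap_init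
    (fun j => mean_recursion j p0)).
have mono : mean_gap k <= mean_gap 0.
  by elim: k => // j; exact/le_trans/mean_gap_nonincreasing.
have : L * (lam * p) * k%:R <= 0.
  by rewrite -mulrA mulr_ge0_le0 ?(ltW hL)// mulr_le0_ge0// mulr_ge0_le0// ltW.
move=> /(ler_wpM2l (mean_gap_ge0 k)); have := mean_gap_init.
move: (k%:R : R) => kk; lra.
Qed.

Lemma expected_gap_rate k :
  let den := 2 * C ^+ 2 * n%:R ^+ 2
    + L * c * M1 * success_prob d C0 eps * (1 - eps) ^+ 2 * d%:R ^+ 2
      * k%:R * step_lower_bound m beta c M2 L in
  0 < den ->
  ('E_P[fun w => (f (x k w) - fstar)%R]
     <= (L * C ^+ 2 * n%:R ^+ 2 * R0 ^+ 2 / den)%:E)%E.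
Proof.
move=> den den_gt0; rewrite unlock -[leLHS]fineK; last first.
  by apply: (integrable_fin_num measurableT); exact: gap_integrable.
rewrite lee_fin -/(Rintegral P setT (gap k)) -/(mean_gap k) ler_pdivlMr//.
have -> : den = b ^+ 2 * (2 + L * (lam * p) * k%:R).
  have Cn : C * n%:R != 0 by rewrite gt_eqF.
  move: Cn; rewrite /den /lam /a /b -/p => Cn.
  have : C != 0 by rewrite gt_eqF.
  have : n%:R != 0 :> R.
    by apply: contraNneq Cn => ->; rewrite mulr0.
  by move=> n0 C0'; field; apply/andP.
rewrite mulrCA (_ : L * _ * _ * _ = b ^+ 2 * (L * R0 ^+ 2)).
  by rewrite ler_wpM2l ?sqr_ge0// mean_gap_rate.
by rewrite /b; ring.
Qed.

End Rate.

End Convergence.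

Theorem theorem6
  (R : realType) (disp : measure_display) (T : measurableType disp)
  (P : probability T R)
  (n d m : nat)
  (hd : (0 < d < n)%N) (hm : (0 < m < n)%N) (m_even : ~~ odd m)
  (f : 'cV[R]_n -> R) (f_C2 : class_C2 f)
  (beta c M1 M2 : R)
  (hbeta : 0 < beta < 1) (hc : 0 < c < 1) (hM : 0 < M1 <= M2)
  (C0 C : R) (hC0 : 0 < C0) (hC : 0 < C)
  (C0P : sketch_constant P n d C0) (CP : gram_constant P n d C)
  (L : R) (hL : 0 < L)
  (f_smooth : forall u v, enorm (grad f u - grad f v) <= L * enorm (u - v))
  (f_convex : convex_function [set: 'cV[R]_n] f)
  (x0 : 'cV[R]_n) (R0 : R) (hR0 : level_radius f x0 = R0%:E)
  (H0 : 'M[R]_m) (hH0 : sym_between M1 M2 H0)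
  (Pinit : 'M[R]_(n, m)) (hPinit : forall j, enorm (col j Pinit) = 1)
  (G : nat -> 'I_n -> 'I_d -> {RV P >-> R}) (hG : gaussian_mx_seq G)
  (Hdeg : nat -> T -> 'M[R]_m)
  (Hdeg_history : forall k, history_determined G k (Hdeg k))
  (Hdeg_bounds : forall k w, sym_between M1 M2 (Hdeg k w))
  (x : nat -> T -> 'cV[R]_n) (H : nat -> T -> 'M[R]_m) (alpha : nat -> T -> R)
  (x_run : forall w, subspace_qn_path f beta c M1 M2 x0 H0 Pinit
             (fun k => rand_mx (G k) w) (Hdeg ^~ w) (x ^~ w) (H ^~ w)
             (alpha ^~ w)) :
  forall (eps : R) (k : nat), 0 < eps < 1 ->
    let den := 2 * C ^+ 2 * n%:R ^+ 2
      + L * c * M1 * success_prob d C0 eps * (1 - eps) ^+ 2 * d%:R ^+ 2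
        * k%:R * step_lower_bound m beta c M2 L in
    0 < den ->
    ('E_P[fun w => (f (x k w) - optimal_value f)%R]
       <= (L * C ^+ 2 * n%:R ^+ 2 * R0 ^+ 2 / den)%:E)%E.
Proof.
move=> eps k heps den den_gt0.
have m_gt0 : (0 < m)%N by case/andP: hm.
exact: (expected_gap_rate hd m_gt0 f_C2 hbeta hc hM hC C0P CP hL f_smooth
  f_convex hR0 hH0 hPinit hG Hdeg_history Hdeg_bounds x_run heps den_gt0).
Qed.
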